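(* Let $A$ and $H$ be self-adjoint operators in a Hilbert space $\mathcal H$ such that $A$ is non-negative and $H$ is bounded and boundedly invertible. Suppose that there exists a self-adjoint involution $J_A\ne\pm I$ commuting with $A$ such that the orthogonal projectors $P_A:=\frac12(I+J_A)$ and $P_A^\bot=I-P_A$ satisfy $P_AHP_A\ge\alpha P_A$ and $P_A^\bot HP_A^\bot\le-\alpha P_A^\bot$ for some $\alpha\in(0,1]$. Let $\mathfrak b[x,y]:=\langle A^{1/2}x,HA^{1/2}y\rangle$ on $\mathrm{Dom}[\mathfrak b]=\mathrm{Dom}(A^{1/2})$, and let $B$ be the self-adjoint operator associated with $\mathfrak b$. If one of the following conditions holds: (a) the operator $H$ maps $\mathrm{Dom}(A^{1/2})$ onto itself; (b) the operator $H$ is strictly positive or strictly negative; (c) the operator $B$ is semibounded; then the domain stability condition $\mathrm{Dom}(|B|^{1/2})=\mathrm{Dom}(A^{1/2})$ is satisfied.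
   Context: A self-adjoint involution is a bounded self-adjoint operator $J$ with $J^2=I$; it commutes with a self-adjoint operator $A$ if $J\,\mathrm{Dom}(A)\subseteq\mathrm{Dom}(A)$ and $JAx=AJx$ for all $x\in\mathrm{Dom}(A)$. The operator $B$ associated with $\mathfrak b$ is the unique self-adjoint operator with $\mathrm{Dom}(B)\subseteq\mathrm{Dom}[\mathfrak b]$ and $\mathfrak b[x,y]=\langle x,By\rangle$ for all $x\in\mathrm{Dom}[\mathfrak b]$, $y\in\mathrm{Dom}(B)$; it exists and equals $A^{1/2}HA^{1/2}$ on its natural domain $\{x\in\mathrm{Dom}(A^{1/2}) : HA^{1/2}x\in\mathrm{Dom}(A^{1/2})\}$. An operator $T$ is strictly positive if $T\ge cI$ for some $c>0$, strictly negative if $-T$ is strictly positive, and semibounded if it is bounded from below or from above. *)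

(* Defs.v *)
From mathcomp Require Import all_boot all_order all_algebra.
From mathcomp Require Import complex.
From mathcomp Require Import all_classical all_reals all_analysis.
Import Order.TTheory GRing.Theory Num.Theory.
Import numFieldNormedType.Exports.

Set Implicit Arguments.
Unset Strict Implicit.
Unset Printing Implicit Defensive.

Local Open Scope classical_set_scope.
Local Open Scope complex_scope.
Local Open Scope ring_scope.

(* A complex Hilbert space is a complete normed module V over R[i] together
   with a library inner product ip : {dot V for Num.conj} inducing its norm.
   The library takes ip linear in its first argument. *)
Definition induces_norm (R : realType) (V : completeNormedModType R[i])
  (ip : {dot V for (@Num.conj R[i])}) : Prop :=
  forall x : V, `|x| ^+ 2 = ip x x.

(* A possibly unbounded linear operator in V: a linear subspace dom and a map
   that is linear on it. The values of app outside dom are irrelevant; this is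
   why op_eq below is used in place of Leibniz equality. *)
Record operator (K : numFieldType) (V : normedModType K) := Operator {
  dom : set V;
  app :> V -> V;
  dom_zero : dom 0;
  dom_linear : forall (a : K) x y, dom x -> dom y -> dom (a *: x + y);
  app_linear : forall (a : K) x y, dom x -> dom y ->
    app (a *: x + y) = a *: app x + app y }.

Section Operators.
Variables (K : numFieldType) (V : normedModType K).
Implicit Types S T : operator V.

Definition op_eq S T : Prop :=
  dom S = dom T /\ forall x, dom S x -> S x = T x.

Lemma total_linear (f : {linear V -> V}) (a : K) (x y : V) :
  setT x -> setT y -> f (a *: x + y) = a *: f x + f y.
Proof. by move=> _ _; rewrite linearP. Qed.

Definition total_op (f : {linear V -> V}) : operator V :=
  @Operator K V setT f I (fun _ _ _ _ _ => I) (@total_linear f).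

Lemma opp_linear T (a : K) x y : dom T x -> dom T y ->
  - T (a *: x + y) = a *: - T x + - T y.
Proof. by move=> hx hy; rewrite app_linear// opprD scalerN. Qed.

Definition opp_op T : operator V :=
  Operator (@dom_zero _ _ T) (@dom_linear _ _ T) (@opp_linear T).

Definition comp_dom S T : set V := [set x | dom T x /\ dom S (T x)].

Lemma app_zero T : T 0 = 0.
Proof.
have := app_linear 1 (dom_zero T) (dom_zero T).
by rewrite !scale1r addr0 => /eqP; rewrite -subr_eq subrr => /eqP.
Qed.

Lemma comp_zero S T : comp_dom S T 0.
Proof. by split; [exact: dom_zero | rewrite app_zero; exact: dom_zero]. Qed.

Lemma comp_dom_linear S T (a : K) x y : comp_dom S T x -> comp_dom S T y ->
  comp_dom S T (a *: x + y).
Proof.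
move=> [hx hSx] [hy hSy]; split; first exact: dom_linear.
by rewrite app_linear//; exact: dom_linear.
Qed.

Lemma comp_linear S T (a : K) x y : comp_dom S T x -> comp_dom S T y ->
  S (T (a *: x + y)) = a *: S (T x) + S (T y).
Proof. by move=> [hx hSx] [hy hSy]; rewrite !app_linear. Qed.

(* The product ST on its natural domain. *)
Definition comp_op S T : operator V :=
  Operator (@comp_zero S T) (@comp_dom_linear S T) (@comp_linear S T).

End Operators.

Section Hilbert.
Variables (R : realType) (V : completeNormedModType R[i]).
Variable ip : {dot V for (@Num.conj R[i])}.
Implicit Types S T A B : operator V.

Definition bounded_op (f : V -> V) : Prop :=
  exists M : R, forall x, `|f x| <= M%:C * `|x|.

Definition boundedly_invertible (f : V -> V) : Prop :=
  exists g : {linear V -> V}, [/\ bounded_op g, cancel f g & cancel g f].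

(* The right-hand side of the equivalence says that (y, z) is in the graph of
   T, the left-hand side that it is in the graph of the adjoint of T. *)
Definition self_adjoint T : Prop :=
  dense (dom T) /\
  forall y z, (forall x, dom T x -> ip (T x) y = ip x z)
              <-> (dom T y /\ T y = z).

(* S <= T on D in the sense of quadratic forms. The order of R[i] compares
   real parts and requires equal imaginary parts. *)
Definition form_le (D : set V) (S T : V -> V) : Prop :=
  forall x, D x -> ip x (S x) <= ip x (T x).

Definition scalar_op (c : R) : V -> V := fun x => c%:C *: x.

Definition nonnegative_op T : Prop := form_le (dom T) (scalar_op 0) T.

Definition strictly_positive T : Prop :=
  exists2 c : R, 0 < c & form_le (dom T) (scalar_op c) T.

Definition strictly_negative T : Prop := strictly_positive (opp_op T).

Definition semibounded T : Prop :=
  (exists c : R, form_le (dom T) (scalar_op c) T) \/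
  (exists c : R, form_le (dom T) T (scalar_op c)).

(* S = A^(1/2), for A self-adjoint and non-negative. *)
Definition is_sqrt A S : Prop :=
  [/\ self_adjoint S, nonnegative_op S & op_eq (comp_op S S) A].

(* C = |B|, for B self-adjoint: |B| = (B^* B)^(1/2) and B^* = B. *)
Definition is_abs B C : Prop := is_sqrt (comp_op B B) C.

Definition self_adjoint_involution (J : {linear V -> V}) : Prop :=
  [/\ bounded_op J, self_adjoint (total_op J) & involutive J].

Definition commutes_with (J : V -> V) A : Prop :=
  (forall x, dom A x -> dom A (J x)) /\
  (forall x, dom A x -> J (A x) = A (J x)).

Definition orth_proj (J : V -> V) : V -> V := fun x => 2^-1 *: (x + J x).

Definition orth_proj_perp (J : V -> V) : V -> V := fun x => x - orth_proj J x.

(* b[x, y] = <S x, H S y>, used with S = A^(1/2) and domain dom S. *)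
Definition sqrt_form S (H : V -> V) (x y : V) : R[i] := ip (S x) (H (S y)).

Definition associated_op (D : set V) (b : V -> V -> R[i]) B : Prop :=
  [/\ self_adjoint B, dom B `<=` D &
      forall x y, D x -> dom B y -> b x y = ip x (B y)].

End Hilbert.

(* Main.v *)
Require Import Defs.
From mathcomp Require Import all_boot all_order all_algebra.
From mathcomp Require Import complex.
From mathcomp Require Import all_classical all_reals all_analysis.
From mathcomp Require Import ring lra.
Import Order.TTheory GRing.Theory Num.Theory.
Import numFieldNormedType.Exports.
Local Open Scope classical_set_scope.
Local Open Scope complex_scope.
Local Open Scope ring_scope.
Set Implicit Arguments.
Unset Strict Implicit.
Unset Printing Implicit Defensive.

(** Write S = A^(1/2), C = |B| and T = |B|^(1/2). No functional calculus is used: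
    the square roots enter only through S^2 = A, T^2 = C and C^2 = B^2.

    The main tool is the Heinz inequality ([heinz_form_le]): if F is self-adjoint
    and strictly positive, G is symmetric and |Gx| <= k |Fx| on the domain of F, then
    <Gx, x> <= k <Fx, x>. With the closed graph theorem ([dom_sub_bounded]) the
    norm bound follows, for self-adjoint G, from the mere inclusion of Dom F in Dom G
    ([form_compare]). Hence, for non-negative self-adjoint operators,
    Dom(P^2) = Dom(Q^2) forces Dom P = Dom Q ([sqrt_dom_sub]): the domain of P^2 is a
    core of P, and a form bound on a core extends to the closure
    ([selfadj_transfer]). By the same core argument C^2 = B^2 gives Dom C = Dom B
    ([same_square_dom_sub]).

    Condition (a). A vector x of Dom S lies in Dom B exactly when H S x lies in Dom S.
    When H maps Dom S onto itself this says that S x lies in Dom S, that is, that x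
    lies in Dom A. So Dom C = Dom B = Dom A, and the roots T and S have equal domains.

    Condition (b) makes <x, Bx> = <Sx, HSx> of constant sign, so it is a case of (c).

    Condition (c). Say B >= c and let t be large. On Dom B the forms of C and of B + t
    are comparable, by Dom C = Dom B. The form of B is bounded by a multiple of
    |Sx|^2. For the converse bound, J commutes with S ([sqrt_commute], again by the
    Heinz inequality), and the block signs of H give alpha |u|^2 <= Re <Ju, Hu>
    ([block_coercive]); with u = Sx this reads alpha |Sx|^2 <= Re b[Jx, x]. Since
    b + t >= 0, the Cauchy-Schwarz inequality bounds the right side by
    (b + t)[x, x]^(1/2) times the graph norm of x, and so |Sx|^2 is bounded by
    (b + t)[x, x] + |x|^2 ([semibounded_coercive]). The graph norms of S and T are
    thus equivalent on Dom B, and Dom S = Dom T follows once Dom B is a core of both.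
    For T it is the domain of T^2. For S ([form_core]), the map S + i carries the
    graph norm to the norm of the space, where b + <., J .> becomes a symmetric
    operator L with alpha |v| <= |Lv|, by the same coercivity; L is onto, and
    preimages under L (S + i) of vectors of Dom S lie in Dom B. If B is bounded above,
    the argument applies to -B, -H and -J. *)

(** * Inequalities for real numbers *)

Lemma le_eps (R : realFieldType) (x k : R) :
  0 <= k -> (forall e, 0 < e -> x <= k * e) -> x <= 0.
Proof.
move=> k0 xk; apply/ler_addgt0Pr => e e0; rewrite add0r.
have k1 : 0 < k + 1 by lra.
apply: le_trans (xk _ (divr_gt0 e0 k1)) _.
rewrite mulrCA ger_pMr// ler_pdivrMr//; lra.
Qed.

Lemma le_of_sqr (R : realFieldType) (x y : R) : 0 <= y -> x ^+ 2 <= y ^+ 2 -> x <= y.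
Proof. by move=> y0 xy; rewrite leNgt; apply/negP => yx; nra. Qed.

(** The minimum over t of a quadratic a + 2 t b + t^2 c is nonnegative only if its
    discriminant is. This yields the Cauchy-Schwarz inequality for quadratic forms
    that are known only on a subspace. *)
Lemma discriminant (R : realFieldType) (a b c : R) : 0 <= c ->
  (forall t, 0 <= a + 2 * t * b + t ^+ 2 * c) -> b ^+ 2 <= a * c.
Proof.
move=> c0 abc.
have [c00|cn0] := eqVneq c 0.
  have [->|bn0] := eqVneq b 0; first by rewrite c00 mulr0 expr0n.
  have := abc (- (a + 1) / (2 * b)).
  have -> : a + 2 * (- (a + 1) / (2 * b)) * b + (- (a + 1) / (2 * b)) ^+ 2 * c = - 1.
    by rewrite c00; field.
  lra.
have cpos : 0 < c by rewrite lt_neqAle eq_sym cn0.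
have := abc (- b / c).
have -> : a + 2 * (- b / c) * b + (- b / c) ^+ 2 * c = (a * c - b ^+ 2) / c by field.
by rewrite pmulr_lge0 ?invr_gt0// subr_ge0.
Qed.

Lemma amgm (R : realFieldType) (z u v d : R) :
  0 <= u -> 0 <= v -> 0 < d -> z ^+ 2 <= u * v ->
  2 * z <= d * u + v / d.
Proof.
move=> u0 v0 d0 zuv; apply: le_of_sqr.
  by rewrite addr_ge0 ?mulr_ge0 ?invr_ge0// ltW.
have -> : (d * u + v / d) ^+ 2 = (d * u - v / d) ^+ 2 + 4 * (u * v).
  by field; rewrite gt_eqF.
have := sqr_ge0 (d * u - v / d); rewrite exprMn; lra.
Qed.

(** The ratios of consecutive terms of a log-convex sequence increase, so each of
    them is bounded by the exponential growth rate of the sequence. *)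
Lemma log_convex_ratio (R : archiRealFieldType) (f : nat -> R) (c K : R) :
  0 < K -> (forall n, 0 <= f n) ->
  (forall n, f n.+1 ^+ 2 <= f n * f n.+2) -> (forall n, f n <= c * K ^+ n) ->
  f 1%N <= K * f 0%N.
Proof.
move=> K0 f_ge0 f_convex f_growth; rewrite leNgt; apply/negP => f_gt.
have f0 : 0 < f 0%N.
  rewrite lt_neqAle f_ge0 andbT; apply/eqP => f00.
  move: f_gt (f_convex 0%N); rewrite -f00 mulr0 mul0r => f1.
  by rewrite leNgt exprn_gt0.
(* If the first ratio s * K exceeded K, convexity would make every later ratio
   at least as large, and s ^+ n would outgrow c. *)
pose s := f 1%N / f 0%N / K.
have sK : s * K = f 1%N / f 0%N by rewrite divfK// gt_eqF.
have s1 : 1 < s by rewrite ltr_pdivlMr// mul1r ltr_pdivlMr.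
clearbody s.
have step n : 0 < f n /\ s * K * f n <= f n.+1.
  elim: n => [|n [fn0 fn]]; first by rewrite sK divfK// gt_eqF.
  have fn1 : 0 < f n.+1 by apply: lt_le_trans fn; rewrite !mulr_gt0//; lra.
  split=> //; rewrite -(ler_pM2l fn0).
  apply: le_trans (f_convex n).
  move: fn; move: (f n) (f n.+1) fn0 fn1 => a b; nra.
have lower n : s ^+ n * K ^+ n * f 0%N <= f n.
  elim: n => [|n IH]; first by rewrite !expr0 !mul1r.
  apply: le_trans (step n).2; rewrite !exprS.
  have -> : s * s ^+ n * (K * K ^+ n) * f 0%N = s * K * (s ^+ n * K ^+ n * f 0%N) by ring.
  by rewrite ler_wpM2l// mulr_ge0 ?ltW//; lra.
have bounded n : s ^+ n * f 0%N <= c.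
  rewrite -(ler_pM2r (exprn_gt0 n K0)); apply: le_trans (f_growth n).
  by apply: le_trans (lower n); rewrite mulrAC.
have bernoulli n : n%:R * (s - 1) <= s ^+ n.
  elim: n => [|n IH]; first by rewrite mul0r expr0.
  have sn1 : 1 <= s ^+ n by rewrite exprn_ege1// ltW.
  rewrite exprS -natr1; nra.
have sf0 : 0 < (s - 1) * f 0%N by rewrite mulr_gt0// subr_gt0.
have c0 : 0 <= c by have := bounded 0%N; rewrite expr0 mul1r; lra.
have := archi_boundP (divr_ge0 c0 (ltW sf0)).
rewrite ltr_pdivrMr// mulrA => h.
have := bounded (Num.bound (c / ((s - 1) * f 0%N))).
have := bernoulli (Num.bound (c / ((s - 1) * f 0%N))); nra.
Qed.

(** * The underlying real Hilbert space *)

Section RealForm.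
Variables (R : realType) (V : completeNormedModType R[i]).
Variables (ip : {dot V for (@Num.conj R[i])}) (ip_norm : induces_norm ip).
Implicit Types (x y z u v w : V) (a b c d e t : R).

(** Re (ip x y) makes V a real Hilbert space, with symmetric bilinear product and
    real norm; the complex structure survives as multiplication by 'i. *)
Definition rip x y : R := complex.Re (ip x y).
Definition nrm x : R := complex.Re `|x|.

Local Notation "''[' x , y ]" := (rip x y) (format "''[' x ,  y ]").

Lemma ripDl x y z : '[x + y, z] = '[x, z] + '[y, z].
Proof. by rewrite /rip linearDl raddfD. Qed.

Lemma ripNl x z : '[- x, z] = - '[x, z].
Proof. by rewrite /rip linearNl raddfN. Qed.

Lemma ripC x y : '[x, y] = '[y, x].
Proof.
rewrite /rip hermC expr0 mul1r.
have Re_conj (c : R[i]) : complex.Re (Num.conj c) = complex.Re c by case: c.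
exact: Re_conj.
Qed.

Lemma ripDr x y z : '[x, y + z] = '[x, y] + '[x, z].
Proof. by rewrite ripC ripDl !(ripC x). Qed.

Lemma ripNr x z : '[x, - z] = - '[x, z].
Proof. by rewrite ripC ripNl ripC. Qed.

Lemma rip0l x : '[0, x] = 0.
Proof. by rewrite /rip linear0l. Qed.

Lemma rip0r x : '[x, 0] = 0.
Proof. by rewrite ripC rip0l. Qed.

Lemma ripZl a x y : '[a%:C *: x, y] = a * '[x, y].
Proof.
rewrite /rip linearZl_LR /=.
have Re_scale (c : R[i]) : complex.Re (a%:C * c) = a * complex.Re c.
  by case: c => p q /=; rewrite mul0r subr0.
exact: Re_scale.
Qed.

Lemma ripZr a x y : '[x, a%:C *: y] = a * '[x, y].
Proof. by rewrite ripC ripZl ripC. Qed.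

Lemma rip_conjr (c : R[i]) x y : '[c *: x, y] = '[x, conjc c *: y].
Proof.
rewrite /rip linearZl_LR linearZr_LR /=.
have -> : Num.conj (conjc c) = c by exact: conjcK.
by [].
Qed.

Definition ripE := (ripDl, ripDr, ripNl, ripNr, ripZl, ripZr, rip0l, rip0r).

Lemma nrmE x : `|x| = (nrm x)%:C.
Proof. by rewrite /nrm RRe_real// normr_real. Qed.

Lemma ripxx x : '[x, x] = nrm x ^+ 2.
Proof. by rewrite /rip -ip_norm nrmE -rmorphXn. Qed.

Lemma nrm_ge0 x : 0 <= nrm x.
Proof. rewrite -lecR -nrmE; exact: normr_ge0. Qed.

Lemma nrm_eq0 x : nrm x = 0 -> x = 0.
Proof. by move=> h; apply/normr0_eq0; rewrite nrmE h. Qed.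

Lemma nrm0 : nrm 0 = 0.
Proof. by rewrite /nrm normr0. Qed.

Lemma nrmD x y : nrm (x + y) <= nrm x + nrm y.
Proof. by rewrite -lecR rmorphD /= -!nrmE ler_normD. Qed.

Lemma nrmN x : nrm (- x) = nrm x.
Proof. by rewrite /nrm normrN. Qed.

Lemma nrmB x y : nrm (x - y) = nrm (y - x).
Proof. by rewrite -nrmN opprB. Qed.

Lemma nrm_tri y x z : nrm (x - z) <= nrm (x - y) + nrm (y - z).
Proof. by rewrite -[X in nrm X](subrKA y) nrmD. Qed.

Lemma nrmZ a x : nrm (a%:C *: x) = `|a| * nrm x.
Proof.
have norm_real : `|a%:C : R[i]| = (`|a|)%:C.
  by rewrite normc_def /= expr0n addr0 sqrtr_sqr.
by apply: complexI; rewrite rmorphM /= -!nrmE normrZ norm_real.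
Qed.

Lemma nrmZc (c : R[i]) x : nrm (c *: x) = complex.Re `|c| * nrm x.
Proof.
by apply: complexI; rewrite rmorphM /= -!nrmE normrZ; congr (_ * _).
Qed.

Lemma nrm_i x : nrm ('i%C *: x) = nrm x.
Proof.
have norm_i : `|'i%C : R[i]| = 1.
  by rewrite normc_def /= expr0n add0r expr1n sqrtr1.
by apply: complexI; rewrite -!nrmE normrZ norm_i mul1r.
Qed.

Lemma pythagoras x y : '[x, y] = 0 -> nrm (x + y) ^+ 2 = nrm x ^+ 2 + nrm y ^+ 2.
Proof. by move=> xy; rewrite -!ripxx !ripE (ripC y x) xy addr0 add0r. Qed.

Lemma rip_le x y : '[x, y] <= nrm x * nrm y.
Proof.
have expand : '[(nrm y)%:C *: x - (nrm x)%:C *: y, (nrm y)%:C *: x - (nrm x)%:C *: y]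
    = 2 * (nrm x * nrm y) * (nrm x * nrm y - '[x, y]).
  by rewrite !ripE !ripxx (ripC y x); ring.
have : 0 <= 2 * (nrm x * nrm y) * (nrm x * nrm y - '[x, y]).
  by rewrite -expand ripxx sqr_ge0.
have [/nrm_eq0 -> _|x0] := eqVneq (nrm x) 0; first by rewrite rip0l nrm0 mul0r.
have [/nrm_eq0 -> _|y0] := eqVneq (nrm y) 0; first by rewrite rip0r nrm0 mulr0.
rewrite pmulr_rge0 ?subr_ge0//.
by rewrite !mulr_gt0// lt_neqAle eq_sym ?x0 ?y0 nrm_ge0.
Qed.

Lemma norm_rip_le x y : `|'[x, y]| <= nrm x * nrm y.
Proof.
rewrite ler_norml rip_le andbT lerNl -ripNl -(nrmN x); exact: rip_le.
Qed.

Lemma rip_inj y z : (forall x, '[x, y] = '[x, z]) -> y = z.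
Proof.
move=> yz; apply/subr0_eq/nrm_eq0/eqP; rewrite -sqrf_eq0 -ripxx.
by rewrite ripDr ripNr yz subrr.
Qed.

(** Completeness for approximate solutions: Phi e x says that x solves some problem
    up to the error e. *)
Lemma nrm_limit (Phi : R -> V -> Prop) :
  (forall e, 0 < e -> exists x, Phi e x) ->
  (forall d e x y, Phi d x -> Phi e y -> nrm (x - y) <= d + e) ->
  exists l, forall e x, Phi e x -> nrm (x - l) <= e.
Proof.
move=> Phi_ex Phi_cauchy.
have /choice[u hu] n : exists x, Phi n.+1%:R^-1 x.
  by apply: Phi_ex; rewrite invr_gt0.
have inv_small e : 0 < e -> \forall n \near \oo, n.+1%:R^-1 < e.
  by move=> e0; exact: (near_infty_natSinv_lt (PosNum e0)).
have cvg_u : cvgn u.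
  apply/cauchy_cvgP/cauchyP => e e0.
  have [d d0 ed] : exists2 d : R, 0 < d & e = d%:C.
    exists (complex.Re e); last by rewrite RRe_real// gtr0_real.
    by move: e0; rewrite ltcE /= => /andP[].
  have half := inv_small _ (divr_gt0 d0 (ltr0Sn R 1)).
  near \oo => m; exists (u m).
  change (\forall n \near \oo, ball (u m) e (u n)).
  near=> n.
  rewrite -ball_normE /ball_ /= nrmE ed ltcR.
  apply: le_lt_trans (Phi_cauchy _ _ _ _ (hu m) (hu n)) _.
  rewrite [d]splitr ltrD//; [near: m|near: n]; exact: half.
exists (lim (u @ \oo)) => e x Phix; apply/ler_addgt0Pr => d d0.
have d20 : 0 < d / 2 by exact: divr_gt0.
have half := inv_small _ d20.
near \oo => n.
apply: le_trans (nrm_tri (u n) _ _) _.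
have : nrm (x - u n) <= e + d / 2.
  apply: le_trans (Phi_cauchy _ _ _ _ Phix (hu n)) _.
  by rewrite lerD2l ltW//; near: n; exact: half.
have : nrm (u n - lim (u @ \oo)) <= d / 2.
  rewrite -lecR -nrmE distrC.
  apply: ltW; near: n.
  have /cvgrPdist_lt := cvg_u; apply.
  by rewrite ltcR.
lra.
Unshelve. all: by end_near. Qed.

(** The projection theorem without a closedness assumption: almost minimisers of the
    distance from v to W are Cauchy by the parallelogram law, and v minus their limit
    is orthogonal to W. *)
Lemma orth_dense (W : set V) v e : W 0 ->
  (forall a x y, W x -> W y -> W (x + a%:C *: y)) ->
  (forall z, (forall w, W w -> '[w, z] = 0) -> z = 0) ->
  0 < e -> exists2 w, W w & nrm (v - w) <= e.
Proof.
move=> W0 W_lin W_orth e0.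
pose Q := [set t | exists2 w, W w & t = nrm (v - w) ^+ 2].
pose m := inf Q.
have Q_lb : lbound Q 0 by move=> _ [w _ ->]; exact: sqr_ge0.
have m_le w : W w -> m <= nrm (v - w) ^+ 2.
  by move=> Ww; apply: ge_inf; [exists 0|exists w].
have m_approx d : 0 < d -> exists2 w, W w & nrm (v - w) ^+ 2 <= m + d.
  move=> d0; have [|_ [w Ww ->] /ltW h] := @inf_adherent _ Q d d0; last by exists w.
  by split; [exists (nrm (v - 0) ^+ 2); exists 0|exists 0].
pose Phi d w := [/\ 0 < d, W w & nrm (v - w) ^+ 2 <= m + d ^+ 2 / 2].
have Phi_ex d : 0 < d -> exists w, Phi d w.
  move=> d0; have [|w Ww hw] := m_approx (d ^+ 2 / 2); last by exists w.
  by rewrite divr_gt0// exprn_gt0.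
have Phi_cauchy c d w w' : Phi c w -> Phi d w' -> nrm (w - w') <= c + d.
  move=> [c0 Ww hw] [d0 Ww' hw'].
  have /m_le := W_lin 2^-1 _ _ Ww (W_lin (-1) _ _ Ww' Ww).
  move=> mid; apply: le_of_sqr; first by lra.
  move: hw hw' mid; rewrite -!ripxx !ripE (ripC w v) (ripC w' v) (ripC w' w).
  nra.
have [l hl] := nrm_limit Phi_ex Phi_cauchy.
have -> : v = l.
  apply/subr0_eq/W_orth => w Ww; apply/eqP; rewrite -normr_le0.
  apply: (@le_eps _ _ (2 * nrm w)) => [|d d0]; first by rewrite mulr_ge0 ?nrm_ge0.
  have [w0 Phiw0] := Phi_ex _ d0; have [_ Ww0 hw0] := Phiw0.
  have h1 := hl _ _ Phiw0.
  have split_rip : '[w, v - l] = '[w, v - w0] + '[w, w0 - l].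
    by rewrite -ripDr subrKA.
  have h2 : `|'[w, v - w0]| <= nrm w * d.
    have [/nrm_eq0 ->|wn0] := eqVneq (nrm w) 0; first by rewrite rip0l nrm0 mul0r normr0.
    have wpos : 0 < nrm w by rewrite lt_neqAle eq_sym wn0 nrm_ge0.
    have /m_le := W_lin ('[w, v - w0] / nrm w ^+ 2) _ _ Ww0 Ww.
    (* t is the coefficient of the best correction of w0 along w. *)
    rewrite opprD addrA => opt.
    move: (v - w0) opt hw0 => u; set t := _ / _ => opt hw0.
    have tE : t * nrm w ^+ 2 = '[w, u] by rewrite divfK// sqrf_eq0.
    clearbody t.
    have : nrm (u - t%:C *: w) ^+ 2 = nrm u ^+ 2 - t ^+ 2 * nrm w ^+ 2.
      rewrite -!ripxx !ripE (ripC u w) -tE !ripxx; ring.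
    move=> optE; rewrite optE in opt.
    apply: le_of_sqr; first by rewrite mulr_ge0 ?nrm_ge0// ltW.
    rewrite real_normK ?num_real// -tE !exprMn.
    have -> : t ^+ 2 * nrm w ^+ 2 ^+ 2 = nrm w ^+ 2 * (t ^+ 2 * nrm w ^+ 2) by ring.
    by rewrite ler_wpM2l ?sqr_ge0//; have := sqr_ge0 d; lra.
  have h3 : `|'[w, w0 - l]| <= nrm w * d.
    by apply: le_trans (norm_rip_le _ _) _; rewrite ler_wpM2l ?nrm_ge0.
  rewrite split_rip; apply: le_trans (ler_normD _ _) _; lra.
have [w Phiw] := Phi_ex _ e0; have [_ Ww _] := Phiw.
by exists w => //; rewrite nrmB; exact: hl.
Qed.

(** * Self-adjoint maps *)

(** Self-adjointness for the real inner product. Density of D and linearity of T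
    are consequences ([selfadj_dense], [selfadj_lin]), so a map may be used
    as soon as its symmetry and maximality are known. *)
Definition selfadj (D : set V) (T : V -> V) : Prop :=
  (forall x y, D x -> D y -> '[T x, y] = '[x, T y]) /\
  (forall y z, (forall x, D x -> '[T x, y] = '[x, z]) -> D y /\ T y = z).

Section SelfAdj.
Variables (D : set V) (T : V -> V) (T_sa : selfadj D T).

Lemma selfadj_lin a x y : D x -> D y ->
  D (x + a%:C *: y) /\ T (x + a%:C *: y) = T x + a%:C *: T y.
Proof.
move=> Dx Dy; apply: T_sa.2 => w Dw.
by rewrite !ripE !T_sa.1.
Qed.

Lemma selfadj0 : D 0 /\ T 0 = 0.
Proof. by apply: T_sa.2 => w Dw; rewrite !rip0r. Qed.

Lemma selfadjB x y : D x -> D y -> D (x - y) /\ T (x - y) = T x - T y.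
Proof.
move=> Dx Dy; apply: T_sa.2 => w Dw.
by rewrite !ripE !T_sa.1.
Qed.

Lemma selfadjD x y : D x -> D y -> D (x + y) /\ T (x + y) = T x + T y.
Proof.
move=> Dx Dy; apply: T_sa.2 => w Dw.
by rewrite !ripE !T_sa.1.
Qed.

Lemma selfadjZ a x : D x -> D (a%:C *: x) /\ T (a%:C *: x) = a%:C *: T x.
Proof.
move=> Dx; apply: T_sa.2 => w Dw.
by rewrite !ripE !T_sa.1.
Qed.

Lemma selfadj_dense v e : 0 < e -> exists2 w, D w & nrm (v - w) <= e.
Proof.
apply: orth_dense; first exact: selfadj0.1.
  by move=> a x y Dx Dy; exact: (selfadj_lin a Dx Dy).1.
move=> z Dz; rewrite -selfadj0.2.
have [|_ ->//] := T_sa.2 0 z.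
by move=> x Dx; rewrite rip0r Dz.
Qed.

Lemma selfadj_closed y z :
  (forall e, 0 < e -> exists x, [/\ D x, nrm (x - y) <= e & nrm (T x - z) <= e]) ->
  D y /\ T y = z.
Proof.
move=> yz; apply: T_sa.2 => w Dw; apply/eqP; rewrite -subr_eq0 -normr_le0.
apply: (@le_eps _ _ (nrm (T w) + nrm w)) => [|e e0].
  by rewrite addr_ge0 ?nrm_ge0.
have [x [Dx xy xz]] := yz e e0.
have -> : '[T w, y] - '[w, z] = '[w, T x - z] - '[T w, x - y].
  rewrite !ripE (T_sa.1 w x)//; ring.
apply: le_trans (ler_normB _ _) _.
have := norm_rip_le w (T x - z); have := norm_rip_le (T w) (x - y).
have := nrm_ge0 w; have := nrm_ge0 (T w); nra.
Qed.

(** The orthogonal complement of the range of T + c is the kernel of its adjoint, which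
    the lower bound for T + c^* makes trivial; the lower bound for T + c and the
    closedness of T turn the dense range into the whole space. *)
Lemma selfadj_surj (c : R[i]) d v : 0 < d ->
  (forall x, D x -> d * nrm x <= nrm (T x + c *: x)) ->
  (forall x, D x -> d * nrm x <= nrm (T x + conjc c *: x)) ->
  exists2 x, D x & T x + c *: x = v.
Proof.
move=> d0 c_below cc_below.
pose W := [set w | exists2 x, D x & w = T x + c *: x].
have W0 : W 0.
  by have [D0 T0] := selfadj0; exists 0 => //; rewrite T0 scaler0 addr0.
have W_lin a x y : W x -> W y -> W (x + a%:C *: y).
  move=> [x' Dx ->] [y' Dy ->]; have [Dxy Txy] := selfadj_lin a Dx Dy.
  exists (x' + a%:C *: y') => //.
  by rewrite Txy !scalerDr !scalerA (mulrC c) addrACA.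
have W_orth z : (forall w, W w -> '[w, z] = 0) -> z = 0.
  move=> Wz; have [|Dz Tz] := T_sa.2 z (- (conjc c *: z)).
    move=> x Dx; apply/eqP; rewrite ripNr -rip_conjr -addr_eq0 -ripDl.
    by apply/eqP/Wz; exists x.
  have := cc_below z Dz; rewrite Tz addNr nrm0 => h.
  apply: nrm_eq0; apply/eqP; rewrite eq_le nrm_ge0 andbT.
  by rewrite -(@pmulr_rle0 _ d).
pose Phi e x := D x /\ nrm (v - (T x + c *: x)) <= d * e.
have Phi_ex e : 0 < e -> exists x, Phi e x.
  move=> e0; have [|_ [x Dx ->] h] := orth_dense v W0 W_lin W_orth (e := d * e).
    exact: mulr_gt0.
  by exists x.
have [l hl] : exists l, forall e x, Phi e x -> nrm (x - l) <= e.
  apply: (nrm_limit Phi_ex) => e f x y [Dx hx] [Dy hy].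
  rewrite -(ler_pM2l d0) mulrDr.
  have [Dxy Txy] := selfadjB Dx Dy.
  apply: le_trans (c_below _ Dxy) _; rewrite Txy.
  have -> : T x - T y + c *: (x - y) = (T x + c *: x) - (T y + c *: y).
    by rewrite scalerBr opprD addrACA.
  by apply: le_trans (nrm_tri v _ _) _; rewrite lerD// nrmB.
have [|Dl Tl] := @selfadj_closed l (v - c *: l); last first.
  by exists l => //; rewrite Tl subrK.
move=> e e0.
set k := complex.Re `|c|.
have k0 : 0 <= k by rewrite -lecR /k RRe_real ?normr_real//; exact: normr_ge0.
have K0 : 0 < 1 + d + k by lra.
have e'0 : 0 < e / (1 + d + k) by exact: divr_gt0.
have [x Phix] := Phi_ex _ e'0; have [Dx hx] := Phix.
have xl := hl _ _ Phix.
have eE : e = e / (1 + d + k) * (1 + d + k) by rewrite divfK// gt_eqF.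
exists x; split => //.
  apply: le_trans xl _; rewrite [leRHS]eE; nra.
have -> : T x - (v - c *: l) = - (v - (T x + c *: x)) - c *: (x - l).
  by rewrite scalerBr !opprB [RHS]addrAC [in RHS]addrACA subrr addr0 addrA.
apply: le_trans (nrmD _ _) _; rewrite !nrmN nrmZc -/k [leRHS]eE; nra.
Qed.

End SelfAdj.

(** * Cores and squares *)

Definition sq_dom (D : set V) (T : V -> V) : set V := [set x | D x /\ D (T x)].

Lemma sq_domB (D : set V) (T : V -> V) x y :
  selfadj D T -> sq_dom D T x -> sq_dom D T y ->
  sq_dom D T (x - y) /\ T (x - y) = T x - T y.
Proof.
move=> T_sa [Dx DTx] [Dy DTy]; have [Dxy Txy] := selfadjB T_sa Dx Dy.
by split=> //; split=> //; rewrite Txy; exact: (selfadjB T_sa _ _).1.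
Qed.

Lemma form_sq (D : set V) (T : V -> V) x :
  selfadj D T -> sq_dom D T x -> '[T (T x), x] = nrm (T x) ^+ 2.
Proof. by move=> T_sa [Dx DTx]; rewrite T_sa.1// ripxx. Qed.

(** With real linearity, this is complex linearity. *)
Definition i_linear (D : set V) (T : V -> V) : Prop :=
  forall x, D x -> D ('i%C *: x) /\ T ('i%C *: x) = 'i%C *: T x.

Section ImaginaryShift.
Variables (D : set V) (S : V -> V) (S_sa : selfadj D S) (S_i : i_linear D S).

Lemma rip_i x y : '['i%C *: x, y] = - '[x, 'i%C *: y].
Proof.
rewrite rip_conjr -ripNr -scaleNr; congr rip; congr (_ *: _).
by apply/eqP; rewrite eq_complex /= oppr0 !eqxx.
Qed.

Lemma rip_app_i x : D x -> '[S x, 'i%C *: x] = 0.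
Proof.
move=> Dx; have [Dix Six] := S_i Dx.
have : '[S x, 'i%C *: x] = - '[S x, 'i%C *: x].
  by rewrite {1}S_sa.1// Six [LHS]ripC rip_i.
lra.
Qed.

(** S + i maps the graph norm of S isometrically to the norm of V, as Re <Sx, ix> = 0. *)
Lemma nrm_shift x : D x -> nrm (S x + 'i%C *: x) ^+ 2 = nrm (S x) ^+ 2 + nrm x ^+ 2.
Proof.
by move=> Dx; rewrite pythagoras ?nrm_i// rip_app_i.
Qed.

Lemma nrm_shiftN x : D x -> nrm (S x - 'i%C *: x) ^+ 2 = nrm (S x) ^+ 2 + nrm x ^+ 2.
Proof.
by move=> Dx; rewrite pythagoras ?nrmN ?nrm_i// ripNr rip_app_i// oppr0.
Qed.

Lemma shift_surj v : exists2 x, D x & S x + 'i%C *: x = v.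
Proof.
apply: (selfadj_surj S_sa (c := 'i%C) v (@ltr01 R)) => x Dx.
  rewrite mul1r; apply: le_of_sqr; rewrite ?nrm_ge0// nrm_shift//.
  by rewrite lerDr sqr_ge0.
have -> : conjc 'i%C = - 'i%C :> R[i] by apply/eqP; rewrite eq_complex /= oppr0 !eqxx.
rewrite mul1r scaleNr; apply: le_of_sqr; rewrite ?nrm_ge0// nrm_shiftN//.
by rewrite lerDr sqr_ge0.
Qed.

Lemma shiftN_surj v : exists2 x, D x & S x - 'i%C *: x = v.
Proof.
have ci : conjc (- 'i%C) = 'i%C :> R[i].
  by apply/eqP; rewrite eq_complex /= oppr0 opprK !eqxx.
have [||x Dx] := selfadj_surj S_sa (c := - 'i%C) v (@ltr01 R).
- move=> x Dx; rewrite mul1r scaleNr; apply: le_of_sqr; rewrite ?nrm_ge0// nrm_shiftN//.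
  by rewrite lerDr sqr_ge0.
- move=> x Dx; rewrite ci mul1r; apply: le_of_sqr; rewrite ?nrm_ge0// nrm_shift//.
  by rewrite lerDr sqr_ge0.
by rewrite scaleNr => xv; exists x.
Qed.

(** The domain of S^2 is a core of S: it is the image under (S + i)^-1 of the dense
    domain of S. *)
Lemma sq_dom_core y e : D y -> 0 < e ->
  exists x, [/\ sq_dom D S x, nrm (x - y) <= e & nrm (S x - S y) <= e].
Proof.
move=> Dy e0.
have [w Dw hw] := selfadj_dense S_sa (S y + 'i%C *: y) e0.
have [x Dx xw] := shift_surj w.
have [Dxy Sxy] := selfadjB S_sa Dx Dy.
have : nrm (S (x - y) + 'i%C *: (x - y)) ^+ 2 <= e ^+ 2.
  rewrite ler_sqr ?nnegrE ?nrm_ge0 ?(ltW e0)//.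
  by rewrite Sxy scalerBr addrACA -opprD xw nrmB.
rewrite nrm_shift// Sxy => h.
have := sqr_ge0 (nrm (S x - S y)); have := sqr_ge0 (nrm (x - y)) => h1 h2.
exists x; split; try by (apply: le_of_sqr; [exact: ltW|lra]).
split=> //; have -> : S x = w - 'i%C *: x by rewrite -xw addrK.
by apply: (selfadjB S_sa _ _).1 => //; exact: (S_i Dx).1.
Qed.

End ImaginaryShift.

(** A bound on Q in terms of P passes from E to the P-closure of E, because Q is closed.
    The vector z stands for the limit of the values of P. *)
Lemma selfadj_transfer (E : set V) (P : V -> V) (DQ : set V) (Q : V -> V) k y z :
  selfadj DQ Q -> 0 <= k ->
  (forall x x', E x -> E x' -> E (x - x') /\ P (x - x') = P x - P x') ->
  (forall x, E x -> DQ x) ->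
  (forall x, E x -> nrm (Q x) ^+ 2 <= k * (nrm (P x) ^+ 2 + nrm x ^+ 2)) ->
  (forall e, 0 < e -> exists x, [/\ E x, nrm (x - y) <= e & nrm (P x - z) <= e]) ->
  DQ y /\ forall e, 0 < e -> exists x,
    [/\ E x, nrm (x - y) <= e, nrm (P x - z) <= e & nrm (Q x - Q y) <= e].
Proof.
move=> Q_sa k0 E_sub EQ Q_le E_core.
have Q_le1 x : E x -> nrm (Q x) <= (k + 1) * (nrm (P x) + nrm x).
  move=> Ex; apply: le_of_sqr.
    by rewrite mulr_ge0 ?addr_ge0 ?nrm_ge0//; lra.
  apply: le_trans (Q_le _ Ex) _.
  have := nrm_ge0 (P x); have := nrm_ge0 x.
  move: (nrm (P x)) (nrm x) => p q q0 p0.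
  have h1 : k * (p ^+ 2 + q ^+ 2) <= (k + 1) ^+ 2 * (p ^+ 2 + q ^+ 2).
    by rewrite ler_wpM2r ?addr_ge0 ?sqr_ge0//; nra.
  apply: le_trans h1 _; rewrite exprMn ler_wpM2l ?sqr_ge0//; nra.
pose h := (2 * (k + 1))^-1.
have h0 : 0 < h by rewrite invr_gt0; lra.
have hk : h * (2 * (k + 1)) = 1 by rewrite mulVf// gt_eqF//; lra.
have h1 : h <= 1 by nra.
pose Phi e w := exists x,
  [/\ E x, w = Q x, 0 < e, nrm (x - y) <= h * e & nrm (P x - z) <= h * e].
have Phi_ex e : 0 < e -> exists w, Phi e w.
  by move=> e0; have [x [Ex xy xz]] := E_core _ (mulr_gt0 h0 e0); exists (Q x), x.
have [l hl] : exists l, forall e w, Phi e w -> nrm (w - l) <= e.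
  apply: (nrm_limit Phi_ex) => d e _ _ [x [Ex -> d0 xy xz]] [x' [Ex' -> e0 xy' xz']].
  have [Exx Pxx] := E_sub _ _ Ex Ex'.
  have [_ <-] := selfadjB Q_sa (EQ _ Ex) (EQ _ Ex').
  apply: le_trans (Q_le1 _ Exx) _; rewrite Pxx.
  have t1 : nrm (P x - P x') <= h * (d + e).
    apply: le_trans (nrm_tri z _ _) _; rewrite mulrDr lerD// nrmB//.
  have t2 : nrm (x - x') <= h * (d + e).
    apply: le_trans (nrm_tri y _ _) _; rewrite mulrDr lerD// nrmB//.
  apply: (@le_trans _ _ ((k + 1) * (2 * (h * (d + e))))).
    rewrite ler_wpM2l//; lra.
  have -> : (k + 1) * (2 * (h * (d + e))) = h * (2 * (k + 1)) * (d + e) by ring.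
  by rewrite hk mul1r.
have all_close e : 0 < e -> exists x,
    [/\ E x, nrm (x - y) <= e, nrm (P x - z) <= e & nrm (Q x - l) <= e].
  move=> e0; have [_ [x [Ex _ _ xy xz]]] := Phi_ex _ e0.
  have he : h * e <= e by nra.
  exists x; split => //; [exact: le_trans xy _|exact: le_trans xz _|].
  by apply: hl; exists x.
have [|Dy Qy] := selfadj_closed Q_sa (y := y) (z := l).
  by move=> e /all_close [x [/EQ Dx xy _ xl]]; exists x.
by rewrite Qy.
Qed.

(** * The Heinz inequality and the closed graph theorem *)

Lemma selfadj_onto (D : set V) (F : V -> V) m v : selfadj D F -> 0 < m ->
  (forall x, D x -> m * nrm x <= nrm (F x)) -> exists2 x, D x & F x = v.
Proof.
move=> F_sa m0 F_below.
have [||x Dx] := selfadj_surj F_sa (c := 0) v m0; last first.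
- by rewrite scale0r addr0 => xv; exists x.
- by move=> x Dx; rewrite conjc0 scale0r addr0; exact: F_below.
- by move=> x Dx; rewrite scale0r addr0; exact: F_below.
Qed.

Lemma coercive_below (D : set V) (F : V -> V) m x : D x ->
  (forall x, D x -> m * nrm x ^+ 2 <= '[F x, x]) -> m * nrm x <= nrm (F x).
Proof.
move=> Dx F_pos.
have [-> |xn0] := eqVneq (nrm x) 0; first by rewrite mulr0 nrm_ge0.
have xpos : 0 < nrm x by rewrite lt_neqAle eq_sym xn0 nrm_ge0.
rewrite -(ler_pM2r xpos); apply: le_trans (rip_le _ _).
by apply: le_trans (F_pos _ Dx); rewrite expr2 mulrA.
Qed.

(** The operator W = F^-1 G is symmetric for the inner product <Fx, y>, and the moments
    <F (W^n x), W^n x> are log-convex by the Cauchy-Schwarz inequality. They grow at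
    most like k^(2n), because |F (W^n x)| <= k^n |Fx|. Hence the first ratio is already
    at most k^2, which bounds <Gx, x> = <F (W x), x>. *)
Lemma heinz_form_le (D : set V) (F G : V -> V) m k x :
  selfadj D F -> 0 < m -> (forall x, D x -> m * nrm x ^+ 2 <= '[F x, x]) ->
  (forall x y, D x -> D y -> '[G x, y] = '[x, G y]) -> 0 < k ->
  (forall x, D x -> nrm (G x) <= k * nrm (F x)) ->
  D x -> '[G x, x] <= k * '[F x, x].
Proof.
move=> F_sa m0 F_pos G_sym k0 G_le Dx.
have F_ge0 y : D y -> 0 <= '[F y, y].
  by move=> Dy; apply: le_trans (F_pos _ Dy); rewrite mulr_ge0 ?sqr_ge0// ltW.
have F_CS y z : D y -> D z -> '[F y, z] ^+ 2 <= '[F y, y] * '[F z, z].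
  move=> Dy Dz; apply: discriminant; first exact: F_ge0.
  move=> t; have [Dyz Fyz] := selfadj_lin F_sa t Dy Dz.
  have := F_ge0 _ Dyz; rewrite Fyz !ripE (F_sa.1 z y)// (ripC z); lra.
have F_below y : D y -> m * nrm y <= nrm (F y).
  by move=> Dy; exact: coercive_below Dy F_pos.
have /choice[W hW] y : exists w, D y -> D w /\ F w = G y.
  by have [w Dw Fw] := selfadj_onto (G y) F_sa m0 F_below; exists w.
pose u n := iter n W x.
have Du n : D (u n) by elim: n => // n Dn; exact: (hW _ Dn).1.
have Fu n : F (u n.+1) = G (u n) by exact: (hW _ (Du n)).2.
pose f n := '[F (u n), u n].
have f1 : f 1%N <= k ^+ 2 * f 0%N.
  apply: (@log_convex_ratio _ f (nrm (F x) ^+ 2 / m)).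
  - exact: exprn_gt0.
  - by move=> n; exact: F_ge0.
  - move=> n; have := F_CS _ _ (Du n) (Du n.+2).
    have <- : '[F (u n), u n.+2] = f n.+1 by rewrite F_sa.1// (Fu n.+1) -G_sym// -Fu.
    exact.
  - move=> n.
    have Fun : nrm (F (u n)) <= k ^+ n * nrm (F x).
      elim: n => [|n IH]; first by rewrite mul1r.
      rewrite Fu; apply: le_trans (G_le _ (Du n)) _.
      by rewrite exprS -mulrA ler_pM2l.
    have h1 := rip_le (F (u n)) (u n).
    have h2 := F_below _ (Du n).
    have -> : nrm (F x) ^+ 2 / m * k ^+ 2 ^+ n = (k ^+ n * nrm (F x)) ^+ 2 / m.
      by rewrite -exprM mulnC exprM; field; rewrite gt_eqF.
    rewrite ler_pdivlMr//.
    have h3 := nrm_ge0 (F (u n)).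
    have h4 : nrm (F (u n)) ^+ 2 <= (k ^+ n * nrm (F x)) ^+ 2.
      by rewrite ler_sqr// nnegrE ?mulr_ge0 ?nrm_ge0// exprn_ge0// ltW.
    apply: le_trans h4; rewrite /f; nra.
have G_sq : '[G x, x] ^+ 2 <= f 1%N * f 0%N.
  by have <- : F (u 1%N) = G x := Fu 0%N; exact: (F_CS _ _ (Du 1%N) Dx).
apply: le_of_sqr; first by rewrite mulr_ge0 ?F_ge0// ltW.
apply: le_trans G_sq _; rewrite exprMn expr2 [in leRHS]expr2 mulrA.
by rewrite ler_wpM2r ?F_ge0// -expr2.
Qed.

(** The Baire category theorem, for a countable closed cover. *)
Lemma closed_cover_ball (E : nat -> set V) :
  (forall n x, ~ E n x -> exists2 r, 0 < r & forall y, nrm (y - x) <= r -> ~ E n y) ->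
  (forall x, exists n, E n x) ->
  exists n x r, 0 < r /\ forall y, nrm (y - x) <= r -> E n y.
Proof.
move=> E_closed E_cover; apply: contrapT => E_thin.
(* A pair (x, r) is the closed ball of centre x and radius r: inside any such
   ball there is one of at most half the radius that misses E n. *)
have step (p : nat * (V * R)) : exists q : V * R, 0 < p.2.2 ->
    [/\ 0 < q.2, q.2 <= p.2.2 / 2 &
        forall y, nrm (y - q.1) <= q.2 -> nrm (y - p.2.1) <= p.2.2 /\ ~ E p.1 y].
  case: p => n [x r] /=.
  have [r0|] := ltrP 0 r; last by exists (x, r).
  have r20 : 0 < r / 2 by exact: divr_gt0.
  have [z zx Ez] : exists2 z, nrm (z - x) <= r / 2 & ~ E n z.
    apply: contrapT => h; apply: E_thin; exists n, x, (r / 2); split=> // y yx.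
    by apply: contrapT => Ey; apply: h; exists y.
  have [s s0 hs] := E_closed _ _ Ez.
  exists (z, Num.min s (r / 2)) => _ /=; split.
  - by rewrite lt_min s0.
  - by rewrite ge_min lexx orbT.
  - move=> y; rewrite le_min => /andP[ys yr]; split; last exact: hs.
    by apply: le_trans (nrm_tri z _ _) _; lra.
have [next hnext] := choice step.
pose ball := fix ball n := if n is m.+1 then next (m, ball m) else (0 : V, 1 : R).
have r0 n : 0 < (ball n).2.
  by elim: n => [|n IH] /=; [exact: ltr01|have [] := hnext (n, ball n) IH].
have r_half n : (ball n.+1).2 <= (ball n).2 / 2 by have [] := hnext (n, ball n) (r0 n).
have nested n y : nrm (y - (ball n.+1).1) <= (ball n.+1).2 ->
    nrm (y - (ball n).1) <= (ball n).2 /\ ~ E n y.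
  by have [_ _] := hnext (n, ball n) (r0 n); apply.
have nested_le m n y : nrm (y - (ball (m + n)%N).1) <= (ball (m + n)%N).2 ->
    nrm (y - (ball m).1) <= (ball m).2.
  elim: n => [|n IH]; first by rewrite addn0.
  by rewrite addnS => /nested[/IH].
have r_small n : (ball n).2 <= n.+1%:R^-1.
  elim: n => [|n IH]; first by rewrite invr1.
  apply: le_trans (r_half n) _; apply: (@le_trans _ _ (n.+1%:R^-1 / 2)).
    by rewrite ler_pM2r ?invr_gt0.
  rewrite -invfM lef_pV2 ?posrE ?mulr_gt0 ?ltr0n//.
  by rewrite -natrM ler_nat muln2 -addnn -[n.+2]addn1 leq_add2l.
pose Phi e x := exists n, x = (ball n).1 /\ (ball n).2 <= e.
have Phi_ex e : 0 < e -> exists x, Phi e x.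
  move=> e0; have := archi_boundP (ltW (divr_gt0 ltr01 e0)).
  set n := Num.bound _; rewrite div1r => ne; exists (ball n).1, n; split=> //.
  apply: le_trans (r_small n) _.
  rewrite -[e]invrK lef_pV2 ?posrE ?invr_gt0//.
  by apply: le_trans (ltW ne) _; rewrite ler_nat.
have [l hl] : exists l, forall e x, Phi e x -> nrm (x - l) <= e.
  apply: (nrm_limit Phi_ex) => d e _ _ [m [-> rm]] [n [-> rn]].
  wlog : m n d e rm rn / (m <= n)%N => [th|mn].
    have [mn|/ltnW nm] := leqP m n; first exact: th.
    by rewrite nrmB (addrC d); exact: th.
  have := @nested_le m (n - m)%N (ball n).1.
  rewrite subnKC// subrr nrm0 nrmB => /(_ (ltW (r0 n))).
  by have := r0 n; lra.
have [n En] := E_cover l.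
have : nrm (l - (ball n.+1).1) <= (ball n.+1).2 by rewrite nrmB; apply: hl; exists n.+1.
by move=> /nested[].
Qed.

Lemma dense_bound (E : set V) w M :
  (forall v e, 0 < e -> exists2 y, E y & nrm (v - y) <= e) -> 0 <= M ->
  (forall y, E y -> '[w, y] <= M * nrm y) -> nrm w <= M.
Proof.
move=> E_dense M0 w_le; rewrite -subr_le0; apply: (@le_eps _ _ 2) => // e e0.
have [y Ey wy] := E_dense w e e0.
have := w_le y Ey; have := rip_le w (w - y); rewrite ripDr ripNr ripxx.
have : nrm y <= nrm w + e.
  have := nrm_tri w y 0; rewrite !subr0 nrmB; lra.
have := nrm_ge0 w; have := nrm_ge0 y; nra.
Qed.

(** The closed graph theorem for G F^-1, by the Baire argument of the uniform boundedness
    principle: v lies in E n when the functionals <F^-1 v, G y>, y in DG of norm 1, are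
    bounded by n. *)
Lemma dom_sub_bounded (D DG : set V) (F G : V -> V) m :
  selfadj D F -> 0 < m -> (forall x, D x -> m * nrm x <= nrm (F x)) ->
  selfadj DG G -> D `<=` DG ->
  exists2 k, 0 < k & forall x, D x -> nrm (G x) <= k * nrm (F x).
Proof.
move=> F_sa m0 F_below G_sa DDG.
pose E n := [set v | forall x y, D x -> F x = v -> DG y -> '[x, G y] <= n%:R * nrm y].
have [n v EnN|v|n [v [r [r0 ball_E]]]] := @closed_cover_ball E.
- have [x [y [Dx Fx Dy gap]]] : exists x y, [/\ D x, F x = v, DG y & n%:R * nrm y < '[x, G y]].
    apply: contrapT => h; apply: EnN => x y Dx Fx Dy.
    by rewrite leNgt; apply/negP => gap; apply: h; exists x, y.
  pose g := '[x, G y] - n%:R * nrm y.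
  have g0 : 0 < g by rewrite subr_gt0.
  have y1 : 0 < 1 + nrm (G y) by have := nrm_ge0 (G y); lra.
  exists (m * g / 2 / (1 + nrm (G y))); first by rewrite !divr_gt0// mulr_gt0.
  move=> v' vv' Ev'.
  have [x' Dx' Fx'] := selfadj_onto v' F_sa m0 F_below.
  have := Ev' x' y Dx' Fx' Dy.
  have [Dxx Fxx] := selfadjB F_sa Dx' Dx.
  have : m * nrm (x' - x) <= m * g / 2 / (1 + nrm (G y)).
    by apply: le_trans (F_below _ Dxx) _; rewrite Fxx Fx' Fx.
  rewrite ler_pdivlMr// => xx.
  have := norm_rip_le (x' - x) (G y); rewrite ler_norml ripDl ripNl => /andP[cs _].
  have : nrm (x' - x) * (1 + nrm (G y)) <= g / 2.
    by rewrite -(ler_pM2l m0) !mulrA.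
  have := nrm_ge0 (x' - x); rewrite /g in g0 *; nra.
- have [x Dx Fx] := selfadj_onto v F_sa m0 F_below.
  have := archi_boundP (nrm_ge0 (G x)); set n := Num.bound _ => /ltW hn.
  exists n => x' y Dx' Fx' Dy.
  have xx' : x' = x.
    have [Dxx Fxx] := selfadjB F_sa Dx' Dx.
    have := F_below _ Dxx; rewrite Fxx Fx' Fx subrr nrm0 => h.
    apply/subr0_eq/nrm_eq0/eqP; rewrite eq_le nrm_ge0 andbT.
    by rewrite -(@pmulr_rle0 _ m).
  rewrite xx' -G_sa.1//; last exact: DDG.
  by apply: le_trans (rip_le _ _) _; rewrite ler_wpM2r ?nrm_ge0.
have [x0 Dx0 Fx0] := selfadj_onto v F_sa m0 F_below.
have n0 : 0 <= n%:R :> R by exact: ler0n.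
have small x : D x -> nrm (F x) <= r -> nrm (G x) <= 2 * n%:R.
  move=> Dx Fx.
  have bound y : DG y -> '[G x, y] <= 2 * n%:R * nrm y.
    move=> Dy; rewrite G_sa.1//; last exact: DDG.
    have [Dxx Fxx] := selfadjD F_sa Dx0 Dx.
    have := ball_E (F (x0 + x)) _ (x0 + x) y Dxx erefl Dy.
    rewrite Fxx Fx0 addrC addKr => /(_ Fx); rewrite ripDl => h1.
    have [DNy GNy] := selfadjZ G_sa (-1) Dy.
    have := ball_E v _ x0 _ Dx0 Fx0 DNy.
    rewrite subrr nrm0 => /(_ (ltW r0)); rewrite GNy ripZr nrmZ normrN1; lra.
  apply: (dense_bound (selfadj_dense G_sa)) => //; lra.
exists ((1 + 2 * n%:R) / r); first by rewrite divr_gt0//; lra.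
move=> x Dx.
have [Fx0'|Fxn0] := eqVneq (nrm (F x)) 0.
  have x_eq0 : x = 0.
    apply/nrm_eq0/eqP; rewrite eq_le nrm_ge0 andbT -(@pmulr_rle0 _ m)//.
    by rewrite -Fx0' F_below.
  by rewrite Fx0' mulr0 x_eq0 (selfadj0 G_sa).2 nrm0.
have Fxpos : 0 < nrm (F x) by rewrite lt_neqAle eq_sym Fxn0 nrm_ge0.
have a0 : 0 < r / nrm (F x) by exact: divr_gt0.
have [Dax Fax] := selfadjZ F_sa (r / nrm (F x)) Dx.
have [_ Gax] := selfadjZ G_sa (r / nrm (F x)) (DDG _ Dx).
have := small _ Dax; rewrite Fax Gax !nrmZ gtr0_norm// divfK// => /(_ (lexx r)).
rewrite [in X in X -> _]mulrAC ler_pdivrMr// [X in _ -> _ <= X]mulrAC ler_pdivlMr//.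
lra.
Qed.

(** * Comparison of square roots *)

Lemma selfadj_shift (D : set V) (T : V -> V) t : selfadj D T ->
  selfadj D (fun x => T x + t%:C *: x).
Proof.
move=> T_sa; split=> [x y Dx Dy|y z yz]; first by rewrite !ripE T_sa.1.
have [|Dy Ty] := T_sa.2 y (z - t%:C *: y); last by rewrite Ty subrK.
by move=> x Dx; have := yz x Dx; rewrite !ripE; lra.
Qed.

Lemma selfadj_opp (D : set V) (T : V -> V) : selfadj D T -> selfadj D (fun x => - T x).
Proof.
move=> T_sa; split=> [x y Dx Dy|y z yz]; first by rewrite !ripE T_sa.1.
have [|Dy Ty] := T_sa.2 y (- z); last by rewrite Ty opprK.
by move=> x Dx; rewrite ripNr -yz// ripNl opprK.
Qed.

Lemma selfadj_setT (T : V -> V) : (forall x y, '[T x, y] = '[x, T y]) -> selfadj setT T.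
Proof.
move=> T_sym; split=> // y z yz; split=> //.
by apply: rip_inj => x; rewrite -T_sym yz.
Qed.

(** The closed graph theorem supplies the norm bound that the Heinz inequality needs. *)
Lemma form_compare (D DG : set V) (F G : V -> V) :
  selfadj D F -> (forall x, D x -> nrm x ^+ 2 <= '[F x, x]) ->
  selfadj DG G -> D `<=` DG ->
  exists2 k, 0 < k & forall x, D x -> '[G x, x] <= k * '[F x, x].
Proof.
move=> F_sa F_ge1 G_sa DDG.
have F_pos x : D x -> 1 * nrm x ^+ 2 <= '[F x, x] by rewrite mul1r; exact: F_ge1.
have [x Dx|k k0 G_le] := dom_sub_bounded F_sa ltr01 _ G_sa DDG.
  exact: coercive_below F_pos.
exists k => // x Dx.
apply: (heinz_form_le F_sa ltr01 F_pos _ k0 G_le Dx) => y z /DDG Dy /DDG Dz.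
exact: G_sa.1.
Qed.

(** Applied to P^2 + 1 and Q^2, [form_compare] bounds |Qx|^2 by |Px|^2 + |x|^2 on the
    domain of P^2, a core of P. *)
Lemma sqrt_dom_sub (DP DQ : set V) (P Q : V -> V) :
  selfadj DP P -> i_linear DP P -> selfadj DQ Q ->
  selfadj (sq_dom DP P) (P \o P) -> selfadj (sq_dom DQ Q) (Q \o Q) ->
  sq_dom DP P `<=` sq_dom DQ Q -> DP `<=` DQ.
Proof.
move=> P_sa P_i Q_sa PP_sa QQ_sa PQ y Dy.
have formP x : sq_dom DP P x -> '[P (P x) + 1%:C *: x, x] = nrm (P x) ^+ 2 + nrm x ^+ 2.
  by move=> Dx; rewrite ripDl (form_sq P_sa Dx) ripZl ripxx mul1r.
have [|k k0 QP] := form_compare (selfadj_shift 1 PP_sa) _ QQ_sa PQ.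
  by move=> x Dx; rewrite [leRHS](formP x Dx) lerDr sqr_ge0.
apply: (selfadj_transfer (E := sq_dom DP P) (P := P) (z := P y) Q_sa
  (ltW k0) _ _ _ _).1.
- by move=> x x' Dx Dx'; exact: sq_domB.
- by move=> x /PQ[].
- move=> x Dx; have := QP x Dx; rewrite /= (formP x Dx).
  by rewrite (form_sq Q_sa (PQ _ Dx)).
- by move=> e e0; have [x [? ? ?]] := sq_dom_core P_sa P_i Dy e0; exists x.
Qed.

Lemma same_square_dom_sub (DP DQ : set V) (P Q : V -> V) :
  selfadj DP P -> i_linear DP P -> selfadj DQ Q ->
  sq_dom DP P `<=` sq_dom DQ Q ->
  (forall x, sq_dom DP P x -> P (P x) = Q (Q x)) -> DP `<=` DQ.
Proof.
move=> P_sa P_i Q_sa PQ PPQQ y Dy.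
apply: (selfadj_transfer (E := sq_dom DP P) (P := P) (z := P y) Q_sa
  (@ler01 R) _ _ _ _).1.
- by move=> x x' Dx Dx'; exact: sq_domB.
- by move=> x /PQ[].
- move=> x Dx; rewrite mul1r -(form_sq Q_sa (PQ _ Dx)) -PPQQ//.
  by rewrite (form_sq P_sa Dx) lerDl sqr_ge0.
- by move=> e e0; have [x [? ? ?]] := sq_dom_core P_sa P_i Dy e0; exists x.
Qed.

Lemma involution_nrm (J : V -> V) x : selfadj setT J -> involutive J -> nrm (J x) = nrm x.
Proof.
move=> J_sa JK.
apply/eqP; rewrite -(@eqrXn2 _ 2) ?nrm_ge0//.
by rewrite -!ripxx J_sa.1// JK.
Qed.

(** A non-negative square root commutes with the involutions that commute with the
    square. Both S and J S J are non-negative roots of the same operator, so they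
    have the same norms, first on the domain of S^2 and then on D; the Heinz inequality
    in both directions gives equality of their forms, and polarisation gives equality
    of the operators. *)
Lemma sqrt_commute (D : set V) (S J : V -> V) :
  selfadj D S -> i_linear D S -> (forall x, D x -> 0 <= '[S x, x]) ->
  selfadj setT J -> involutive J ->
  (forall x, sq_dom D S x -> sq_dom D S (J x) /\ J (S (S x)) = S (S (J x))) ->
  forall x, D x -> D (J x) /\ S (J x) = J (S x).
Proof.
move=> S_sa S_i S_ge0 J_sa JK J_comm.
have J_nrm x : nrm (J x) = nrm x by exact: involution_nrm.
have Q_sa : selfadj [set x | D (J x)] (fun x => J (S (J x))).
  split=> [x y Dx Dy|y z yz]; first by rewrite J_sa.1// S_sa.1// J_sa.1.
  have [|Dy Sy] := S_sa.2 (J y) (J z); last by rewrite Sy JK.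
  move=> w Dw; rewrite -J_sa.1// -[in LHS](JK w) yz ?J_sa.1//=; last by rewrite JK.
have SJ_nrm x : sq_dom D S x -> nrm (S (J x)) ^+ 2 = nrm (S x) ^+ 2.
  move=> Dx; have [DJx JSS] := J_comm x Dx.
  by rewrite -!(form_sq S_sa)// -JSS J_sa.1// JK.
have JD_le y : D y -> D (J y) /\ nrm (S (J y)) <= nrm (S y).
  move=> Dy.
  have [|||e e0|DJy close] := selfadj_transfer (E := sq_dom D S) (P := S)
    (y := y) (z := S y) Q_sa (@ler01 R).
  - by move=> x x' Dx Dx'; exact: sq_domB.
  - by move=> x /J_comm[[]].
  - by move=> x Dx; rewrite mul1r J_nrm SJ_nrm// lerDl sqr_ge0.
  - by have [x [? ? ?]] := sq_dom_core S_sa S_i Dy e0; exists x.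
  split=> //; rewrite -subr_le0; apply: (@le_eps _ _ 2) => // e e0.
  have [x [Dx xy Sxy Qxy]] := close e e0.
  have Sx : nrm (S (J x)) = nrm (S x).
    by apply/eqP; rewrite -(@eqrXn2 _ 2) ?nrm_ge0// SJ_nrm.
  have h1 := nrm_tri (J (S (J x))) (J (S (J y))) 0.
  have h2 := nrm_tri (S y) (S x) 0.
  move: h1 h2; rewrite !subr0 !J_nrm Sx (nrmB (J (S (J y)))); lra.
have form_le x : D x -> '[S (J x), J x] <= '[S x, x].
  move=> Dx; have [DJx _] := JD_le x Dx.
  rewrite -subr_le0; apply: (@le_eps _ _ (nrm x ^+ 2)); first exact: sqr_ge0.
  move=> e e0.
  have Fe_pos y : D y -> e * nrm y ^+ 2 <= '[S y + e%:C *: y, y].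
    by move=> Dy; rewrite ripDl ripZl ripxx lerDr S_ge0.
  (* S alone need not be strictly positive, hence the shift by e. *)
  have := @heinz_form_le D (fun y => S y + e%:C *: y) (fun y => J (S (J y))) e 1 x
    (selfadj_shift e S_sa) e0 Fe_pos _ ltr01 _ Dx.
  rewrite mul1r ripDl ripZl ripxx J_sa.1// => h.
  suff : '[S (J x), J x] <= '[S x, x] + e * nrm x ^+ 2 by lra.
  apply: h => [y z Dy Dz|y Dy].
    by have [DJy _] := JD_le y Dy; have [DJz _] := JD_le z Dz; rewrite J_sa.1// S_sa.1// J_sa.1.
  rewrite mul1r J_nrm; apply: le_trans (JD_le y Dy).2 _.
  apply: le_of_sqr; first exact: nrm_ge0.
  rewrite -!ripxx !ripE (ripC y (S y)).
  have := S_ge0 y Dy; have := sqr_ge0 (nrm y); rewrite -ripxx => h1 h2.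
  have : 0 <= e * '[S y, y] by rewrite mulr_ge0// ltW.
  have : 0 <= e * (e * '[y, y]) by rewrite !mulr_ge0// ltW.
  lra.
have form_eq x : D x -> '[S (J x), J x] = '[S x, x].
  move=> Dx; have [DJx _] := JD_le x Dx.
  by apply/eqP; rewrite eq_le form_le//=; have := form_le _ DJx; rewrite JK.
have polar x y : D x -> D y -> '[S (J x), J y] = '[S x, y].
  move=> Dx Dy; have [DJx _] := JD_le x Dx; have [DJy _] := JD_le y Dy.
  have [Dxy Sxy] := selfadjD S_sa Dx Dy.
  have [_ SJxy] := selfadjD S_sa DJx DJy.
  have [_ Jxy] := selfadjD J_sa (x := x) (y := y) I I.
  have := form_eq _ Dxy; rewrite Jxy SJxy Sxy !ripE.
  rewrite !form_eq// (S_sa.1 y x)// (S_sa.1 (J y))// (ripC y) (ripC (J y)); lra.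
move=> x Dx; have [DJx _] := JD_le x Dx; split=> //.
have [|_ ->] := S_sa.2 x (J (S (J x))); last by rewrite JK.
move=> w Dw; have [DJw _] := JD_le w Dw.
by rewrite -J_sa.1// -S_sa.1// polar.
Qed.

(** * Semibounded forms with a coercive block structure *)

Section Coercive.
Variables (D : set V) (S : V -> V) (S_sa : selfadj D S) (S_i : i_linear D S).
Variables (H : V -> V) (H_sa : selfadj setT H).
Variables (M : R) (M0 : 0 < M) (H_le : forall x, nrm (H x) <= M * nrm x).
Variables (J : V -> V) (J_sa : selfadj setT J) (JK : involutive J).
Hypothesis J_i : i_linear setT J.
Hypothesis JS : forall x, D x -> D (J x) /\ S (J x) = J (S x).
Variables (alpha : R) (alpha0 : 0 < alpha) (alpha1 : alpha <= 1).
Hypothesis H_coercive : forall u, alpha * nrm u ^+ 2 <= '[J u, H u].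
Variables (DB : set V) (B : V -> V) (B_sa : selfadj DB B) (DBD : DB `<=` D).
Hypothesis B_form : forall x y, D x -> DB y -> '[S x, H (S y)] = '[x, B y].

(** The adjoint of (S + i)^-1 is (S - i)^-1. *)
Lemma rip_shift x w : D x -> D w ->
  '[S x + 'i%C *: x, w] = '[x, S w - 'i%C *: w].
Proof. by move=> Dx Dw; rewrite ripDl S_sa.1// rip_i ripDr ripNr. Qed.

(** The adjoint of S (S + i)^-1 is S (S - i)^-1. *)
Lemma rip_shift_range x w : D x -> D w ->
  '[S x + 'i%C *: x, S w] = '[S x, S w - 'i%C *: w].
Proof.
move=> Dx Dw; have [Dix Six] := S_i Dx.
by rewrite ripDl -(S_sa.1 ('i%C *: x))// Six rip_i ripDr ripNr.
Qed.

Lemma form_dom x z : D x -> (forall w, D w -> '[S w, H (S x)] = '[w, z]) -> DB x.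
Proof.
move=> Dx xz; apply: (B_sa.2 x z _).1 => w DBw.
rewrite ripC -B_form//.
by rewrite -H_sa.1// ripC; apply: xz; exact: DBD.
Qed.

(** The domain of B is a core of S because the form b + <., J .> is nondegenerate on
    the domain of S with its graph norm. *)
Lemma form_core y e : D y -> 0 < e ->
  exists x, [/\ DB x, nrm (x - y) <= e & nrm (S x - S y) <= e].
Proof.
move=> Dy e0.
have /choice[Rp hRp] v : exists x, D x /\ S x + 'i%C *: x = v.
  by have [x Dx xv] := shift_surj S_sa S_i v; exists x.
have /choice[Rm hRm] v : exists x, D x /\ S x - 'i%C *: x = v.
  by have [x Dx xv] := shiftN_surj S_sa S_i v; exists x.
have RpK x : D x -> Rp (S x + 'i%C *: x) = x.
  move=> Dx; have [Dp Sp] := hRp (S x + 'i%C *: x).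
  move: (Rp _) Dp Sp => p Dp Sp; have [Dpx Spx] := selfadjB S_sa Dp Dx.
  have := nrm_shift S_sa S_i Dpx.
  have -> : S (p - x) + 'i%C *: (p - x) = 0.
    by rewrite Spx scalerBr addrACA -opprD Sp subrr.
  rewrite nrm0 expr0n /= => h; apply/subr0_eq/nrm_eq0/eqP; rewrite -sqrf_eq0.
  rewrite eq_le sqr_ge0 andbT; have := sqr_ge0 (nrm (S (p - x))); lra.
(* L represents the form b + <., J .> in the coordinate v = S x + i x. *)
pose L v := S (Rm (H (S (Rp v)))) + Rm (J (Rp v)).
have formL x w : D x -> D w ->
    '[S w + 'i%C *: w, L (S x + 'i%C *: x)] = '[S w, H (S x)] + '[w, J x].
  move=> Dx Dw; rewrite /L RpK// ripDr.
  have [DH SH] := hRm (H (S x)); have [DJ SJ] := hRm (J x).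
  by rewrite rip_shift_range// rip_shift// SH SJ.
have L_sym u v : '[L u, v] = '[u, L v].
  have [Du <-] := hRp u; have [Dv <-] := hRp v.
  by rewrite ripC !formL// -H_sa.1// -J_sa.1// ripC (ripC (J _)).
have L_sa : selfadj setT L by exact: selfadj_setT.
have L_below v : setT v -> alpha * nrm v <= nrm (L v).
  move=> _; have [-> |vn0] := eqVneq (nrm v) 0; first by rewrite mulr0 nrm_ge0.
  have vpos : 0 < nrm v by rewrite lt_neqAle eq_sym vn0 nrm_ge0.
  have JL : alpha * nrm v ^+ 2 <= '[J v, L v].
    have [Dx <-] := hRp v; move: (Rp v) Dx => x Dx; have [DJx SJx] := JS Dx.
    have [_ ->] := selfadjD J_sa (x := S x) (y := 'i%C *: x) I I.
    have [_ ->] := J_i (x := x) I.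
    rewrite -SJx formL// ripxx (involution_nrm x)// SJx (nrm_shift S_sa S_i Dx).
    have : alpha * nrm x ^+ 2 <= nrm x ^+ 2 by rewrite ler_piMl ?sqr_ge0.
    have := H_coercive (S x). lra.
  rewrite -(ler_pM2r vpos) -mulrA -expr2; apply: le_trans JL _.
  by apply: le_trans (rip_le _ _) _; rewrite involution_nrm// mulrC.
have ae0 : 0 < alpha * e by exact: mulr_gt0.
have [p Dp hp] := selfadj_dense S_sa (L (S y + 'i%C *: y)) ae0.
have [u _ Lu] := selfadj_onto p L_sa alpha0 L_below.
have [Dx xu] := hRp u; move: (Rp u) Dx xu => x Dx xu.
have close : nrm (S (x - y) + 'i%C *: (x - y)) <= e.
  have [_ ->] := selfadjB S_sa Dx Dy.
  rewrite scalerBr addrACA -opprD xu -(ler_pM2l alpha0).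
  apply: le_trans (L_below _ I) _.
  have [_ ->] := selfadjB L_sa (x := u) (y := S y + 'i%C *: y) I I.
  by rewrite Lu nrmB.
have [Dxy Sxy] := selfadjB S_sa Dx Dy.
have := nrm_shift S_sa S_i Dxy; rewrite Sxy => pyth.
have close2 : nrm (S x - S y + 'i%C *: (x - y)) ^+ 2 <= e ^+ 2.
  by rewrite ler_sqr ?nnegrE ?nrm_ge0 ?(ltW e0)// -Sxy.
have h1 := sqr_ge0 (nrm (S x - S y)); have h2 := sqr_ge0 (nrm (x - y)).
exists x; split; try by (apply: le_of_sqr; [exact: ltW|lra]).
apply: (@form_dom x (S p - 'i%C *: p - J x)) => // w Dw.
rewrite ripDr ripNr -rip_shift// -Lu -xu formL//; ring.
Qed.

Lemma form_upper_bound x : D x -> '[S x, H (S x)] <= M * nrm (S x) ^+ 2.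
Proof.
move=> Dx; apply: le_trans (rip_le _ _) _.
by rewrite expr2 mulrCA ler_wpM2l ?nrm_ge0.
Qed.

(** The lower bound of B extends from Dom B to the form domain, which is needed because
    J maps Dom B only into the form domain. *)
Lemma semibounded_form_ge0 t x :
  (forall y, DB y -> 0 <= '[B y, y] + t * nrm y ^+ 2) -> 0 <= t ->
  D x -> 0 <= '[S x, H (S x)] + t * nrm x ^+ 2.
Proof.
move=> Bt_ge0 t0 Dx; rewrite -oppr_le0.
have Sx0 := nrm_ge0 (S x); have x0 := nrm_ge0 x.
(* The constant is that of the change of the form when x moves by at most e <= 1 in the
   graph norm. *)
apply: (@le_eps _ _ (2 * M * nrm (S x) + M + 2 * t * nrm x + t)).
  by rewrite !addr_ge0 ?mulr_ge0// ltW.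
move=> e e0.
have e'0 : 0 < Num.min e 1 by rewrite lt_min e0 ltr01.
have [y [DBy]] := form_core Dx e'0.
set d := y - x; set s := S y - S x => dy sy.
have := Bt_ge0 y DBy; rewrite ripC -B_form//; last exact: DBD.
have -> : y = x + d by rewrite addrC subrK.
have [_ Hxs] := selfadjD H_sa (x := S x) (y := s) I I.
have -> : S (x + d) = S x + s by rewrite /s /d addrC subrK addrC subrK.
clearbody d s.
rewrite Hxs -[in X in X -> _]ripxx !ripE (ripC d x) !ripxx.
move: dy sy; rewrite !le_min => /andP[de d1] /andP[se s1].
have c1 : '[s, H (S x)] <= e * (M * nrm (S x)).
  by apply: le_trans (rip_le _ _) _; apply: ler_pM => //; exact: nrm_ge0.
have c2 : '[S x, H s] <= e * (M * nrm (S x)) by rewrite -H_sa.1// ripC.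
have c3 : '[s, H s] <= e * M.
  apply: le_trans (rip_le _ _) _; apply: ler_pM; rewrite ?nrm_ge0//.
  by apply: le_trans (H_le _) _; rewrite -[leRHS]mulr1 ler_pM2l.
have c4 : '[x, d] <= e * nrm x.
  by rewrite mulrC; apply: le_trans (rip_le _ _) _; rewrite ler_wpM2l.
have c5 : nrm d ^+ 2 <= e.
  by rewrite expr2 -[leRHS]mulr1; apply: ler_pM; rewrite ?nrm_ge0.
have c4' : t * '[x, d] <= t * (e * nrm x) by rewrite ler_wpM2l.
have c5' : t * nrm d ^+ 2 <= t * e by rewrite ler_wpM2l.
lra.
Qed.

(** From alpha |Sx|^2 <= b[Jx, x] = z - t <Jx, x>, with z = (b + t)[Jx, x] controlled by the
    Cauchy-Schwarz inequality for the non-negative form b + t. *)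
Lemma semibounded_coercive t : 0 <= t ->
  (forall y, DB y -> 0 <= '[B y, y] + t * nrm y ^+ 2) ->
  exists2 K, 0 < K &
    forall x, DB x -> nrm (S x) ^+ 2 <= K * ('[B x, x] + t * nrm x ^+ 2 + nrm x ^+ 2).
Proof.
move=> t0 Bt_ge0.
(* With this weight the arithmetic-geometric mean inequality bounds 2 z by
   alpha |Sx|^2 and terms in (b + t)[x, x] and |x|^2, while coercivity bounds 2 z
   from below by 2 alpha |Sx|^2 up to a multiple of |x|^2. *)
pose d := alpha / M; have d0 : 0 < d by exact: divr_gt0.
have dM : d * M = alpha by rewrite divfK// gt_eqF.
clearbody d.
exists (d^-1 * alpha^-1 + (d * t + 2 * t) * alpha^-1 + 1).
  by rewrite ltr_wpDl// addr_ge0// mulr_ge0// ?addr_ge0 ?mulr_ge0 ?invr_ge0// ltW.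
move=> x DBx; have Dx := DBD DBx; have [DJx SJx] := JS Dx.
pose b := '[B x, x] + t * nrm x ^+ 2.
have bE : b = '[S x, H (S x)] + t * nrm x ^+ 2 by rewrite /b ripC B_form.
have b0 : 0 <= b by exact: Bt_ge0.
pose u := M * nrm (S x) ^+ 2 + t * nrm x ^+ 2.
have u0 : 0 <= u.
  by apply: addr_ge0; apply: mulr_ge0; rewrite ?sqr_ge0//; exact: ltW.
pose z := '[S (J x), H (S x)] + t * '[J x, x].
have zub : z ^+ 2 <= u * b.
  apply: (@le_trans _ _ (('[S (J x), H (S (J x))] + t * nrm (J x) ^+ 2) * b)); last first.
    rewrite ler_wpM2r// (involution_nrm x)// lerD2r.
    by apply: le_trans (form_upper_bound DJx) _; rewrite SJx involution_nrm.
  apply: discriminant => // r.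
  have [Dw Sw] := selfadj_lin S_sa r DJx Dx.
  have [_ Hw] := selfadj_lin H_sa r (x := S (J x)) (y := S x) I I.
  have := semibounded_form_ge0 Bt_ge0 t0 Dw.
  rewrite Sw Hw bE -!ripxx !ripE /z.
  rewrite -(H_sa.1 (S x) (S (J x)))// (ripC (H _)) (ripC x (J x)); lra.
have := amgm u0 b0 d0 zub.
have : alpha * nrm (S x) ^+ 2 <= '[S (J x), H (S x)] by rewrite SJx; exact: H_coercive.
have : - '[J x, x] <= nrm x ^+ 2.
  by rewrite -ripNl; apply: le_trans (rip_le _ _) _; rewrite nrmN involution_nrm.
move: (nrm_ge0 x) => x0 h1 h2 h3.
have h4 : - (t * '[J x, x]) <= t * nrm x ^+ 2 by rewrite -mulrN ler_wpM2l.
have h5 : alpha * nrm (S x) ^+ 2 <= (d * t + 2 * t) * nrm x ^+ 2 + b / d.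
  have : d * u = alpha * nrm (S x) ^+ 2 + d * t * nrm x ^+ 2.
    by rewrite /u mulrDr !mulrA dM.
  move: h3; rewrite /z; lra.
rewrite -(ler_pM2l alpha0); apply: le_trans h5 _.
have -> : alpha * ((d^-1 * alpha^-1 + (d * t + 2 * t) * alpha^-1 + 1) * (b + nrm x ^+ 2))
   = (d^-1 + (d * t + 2 * t) + alpha) * (b + nrm x ^+ 2).
  by field; rewrite !gt_eqF.
have q0 := sqr_ge0 (nrm x).
have d0' := ltW d0.
have e1 : 0 <= d^-1 * nrm x ^+ 2 by apply: mulr_ge0; rewrite ?invr_ge0.
have e2 : 0 <= (d * t + 2 * t) * b.
  by apply: mulr_ge0 => //; apply: addr_ge0; apply: mulr_ge0.
have e3 : 0 <= alpha * (b + nrm x ^+ 2).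
  by apply: mulr_ge0; [exact: ltW|exact: addr_ge0].
lra.
Qed.

(** Both inclusions are transfers along Dom B, a core of S and of T. *)
Lemma semibounded_sqrt_dom (DT : set V) (T : V -> V) c :
  (forall x, DB x -> c * nrm x ^+ 2 <= '[B x, x]) ->
  selfadj DT T -> i_linear DT T -> selfadj (sq_dom DT T) (T \o T) ->
  sq_dom DT T = DB -> DT = D.
Proof.
move=> B_ge T_sa T_i TT_sa DT_DB.
pose t := `|c| + 1.
have t0 : 0 <= t by rewrite addr_ge0.
have Bt_ge x : DB x -> nrm x ^+ 2 <= '[B x, x] + t * nrm x ^+ 2.
  move=> DBx; have := B_ge x DBx; have := sqr_ge0 (nrm x).
  have := ler_norm (- c); rewrite normrN /t; nra.
have Bt_ge0 y : DB y -> 0 <= '[B y, y] + t * nrm y ^+ 2.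
  by move=> DBy; apply: le_trans (Bt_ge y DBy); exact: sqr_ge0.
have Bt_sa := selfadj_shift t B_sa.
have T1_sa := selfadj_shift 1 TT_sa.
have formT x : DB x -> '[T (T x) + 1%:C *: x, x] = nrm (T x) ^+ 2 + nrm x ^+ 2.
  by rewrite -DT_DB => Dx; rewrite ripDl (form_sq T_sa Dx) ripZl ripxx mul1r.
have formB x : '[B x + t%:C *: x, x] = '[B x, x] + t * nrm x ^+ 2.
  by rewrite !ripE ripxx.
have [||k1 k10 TB] := form_compare Bt_sa _ TT_sa.
- by move=> x DBx; rewrite formB; exact: Bt_ge.
- by rewrite DT_DB.
have [||k2 k20 BT] := form_compare T1_sa _ B_sa.
- by move=> x; rewrite DT_DB => DBx; rewrite [leRHS]formT// lerDr sqr_ge0.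
- by rewrite DT_DB.
have DB_sub x x' : DB x -> DB x' -> DB (x - x').
  by move=> Dx Dx'; exact: (selfadjB B_sa Dx Dx').1.
have DB_DT x : DB x -> DT x by rewrite -DT_DB => -[].
have [K K0 S_le] := semibounded_coercive t0 Bt_ge0.
apply/seteqP; split=> y Dy.
- have k3 : 0 <= K * (k2 + t + 1) by rewrite mulr_ge0 ?addr_ge0// ltW.
  apply: (selfadj_transfer (E := DB) (P := T) (z := T y) S_sa k3 _ _ _ _).1.
  + move=> x x' Dx Dx'; split; first exact: DB_sub.
    exact: (selfadjB T_sa (DB_DT _ Dx) (DB_DT _ Dx')).2.
  + exact: DBD.
  + move=> x DBx; apply: le_trans (S_le x DBx) _; rewrite -mulrA ler_pM2l//.
    have := BT x; rewrite DT_DB formT// => /(_ DBx).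
    have := mulr_ge0 t0 (sqr_ge0 (nrm (T x))); have := sqr_ge0 (nrm (T x)); lra.
  + move=> e e0; have [x [? ? ?]] := sq_dom_core T_sa T_i Dy e0; exists x; split=> //.
    by rewrite -DT_DB.
- have k3 : 0 <= k1 * (M + t) by rewrite mulr_ge0 ?addr_ge0// ltW.
  apply: (selfadj_transfer (E := DB) (P := S) (z := S y) T_sa k3 _ _ _ _).1.
  + move=> x x' Dx Dx'; split; first exact: DB_sub.
    exact: (selfadjB S_sa (DBD Dx) (DBD Dx')).2.
  + exact: DB_DT.
  + move=> x DBx; have Dx := DBD DBx.
    have := TB x DBx; rewrite formB /= (ripC (B x)) -B_form//.
    have DTx : sq_dom DT T x by rewrite DT_DB.
    rewrite (form_sq T_sa DTx) => /le_trans; apply.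
    rewrite -mulrA ler_pM2l//.
    have := form_upper_bound Dx; have := sqr_ge0 (nrm x).
    have := mulr_ge0 t0 (sqr_ge0 (nrm (S x))); have := mulr_ge0 (ltW M0) (sqr_ge0 (nrm x)).
    lra.
  + by move=> e e0; exact: form_core.
Qed.

End Coercive.

(** * From complex operators to the real setting *)

Lemma self_adjoint_selfadj (T : operator V) : self_adjoint ip T -> selfadj (dom T) T.
Proof.
move=> [_ T_adj]; split=> [x y Dx Dy|y z yz].
  by rewrite /rip ((T_adj y (T y)).2 _ x Dx).
(* The imaginary part of <Tx, y> is read off from the vector i x. *)
apply/T_adj => x Dx; apply/eqP; rewrite eq_complex; apply/andP; split; apply/eqP.
  exact: yz.
have Dix : dom T ('i%C *: x).
  by rewrite -[_ *: _]addr0; apply: dom_linear => //; exact: dom_zero.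
have Tix : T ('i%C *: x) = 'i%C *: T x.
  rewrite -{1}[_ *: _]addr0 app_linear//; last exact: dom_zero.
  by rewrite app_zero addr0.
have Re_i (c : R[i]) : complex.Re ('i%C * c) = - complex.Im c by rewrite mulrC ReiNIm.
have := yz _ Dix; rewrite Tix /rip !linearZl_LR /= !Re_i; exact: oppr_inj.
Qed.

Lemma operator_i_linear (T : operator V) : i_linear (dom T) T.
Proof.
move=> x Dx; rewrite -[_ *: x]addr0; split.
  by apply: dom_linear => //; exact: dom_zero.
by rewrite app_linear ?app_zero ?addr0//; exact: dom_zero.
Qed.

Lemma selfadj_ext (D D' : set V) (T T' : V -> V) :
  D = D' -> (forall x, D x -> T x = T' x) -> selfadj D T -> selfadj D' T'.
Proof.
move=> <- TT' [T_sym T_max]; split=> [x y Dx Dy|y z yz]; first by rewrite -!TT'// T_sym.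
have [|Dy Ty] := T_max y z; last by rewrite -TT'.
by move=> x Dx; rewrite TT'// yz.
Qed.

Lemma form_le_rip (D : set V) (P Q : V -> V) x :
  form_le ip D P Q -> D x -> '[P x, x] <= '[Q x, x].
Proof. by move=> PQ /PQ; rewrite lecE => /andP[_]; rewrite ![in '[_, x]]ripC. Qed.

(** With p = P u and q = u - p, one has Ju = p - q, and the off-diagonal terms <p, Hq> and
    -<q, Hp> of Re <Ju, Hu> cancel. *)
Lemma block_coercive (J H : {linear V -> V}) (alpha : R) u :
  selfadj setT H -> involutive J ->
  form_le ip setT (fun x => alpha%:C *: orth_proj J x)
    (fun x => orth_proj J (H (orth_proj J x))) ->
  form_le ip setT (fun x => orth_proj_perp J (H (orth_proj_perp J x)))
     (fun x => - (alpha%:C *: orth_proj_perp J x)) ->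
  selfadj setT J ->
  alpha * nrm u ^+ 2 <= '[J u, H u].
Proof.
move=> H_sa JK PHP QHQ J_sa.
have half x : 2^-1 *: x = (2^-1 : R)%:C *: x.
  by rewrite fmorphV rmorph_nat.
set p := orth_proj J u; set q := orth_proj_perp J u.
have uE : u = p + q by rewrite /q /orth_proj_perp addrC subrK.
have P_sym x y : '[orth_proj J x, y] = '[x, orth_proj J y].
  by rewrite /orth_proj !half !ripE (J_sa.1 x y).
have Q_sym x y : '[orth_proj_perp J x, y] = '[x, orth_proj_perp J y].
  by rewrite /orth_proj_perp !ripE P_sym.
have JuE : J u = p - q.
  by apply: rip_inj => x; rewrite /p /q /orth_proj_perp /orth_proj half !ripE; lra.
have := form_le_rip PHP (x := u) I.
have := form_le_rip QHQ (x := u) I.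
rewrite P_sym Q_sym -/p -/q ripNl !ripZl => h1 h2.
rewrite JuE {2}uE.
have [_ ->] := selfadjD H_sa (x := p) (y := q) I I.
have -> : nrm u ^+ 2 = '[p, u] + '[q, u] by rewrite -ripDl -uE ripxx.
clearbody p q; move: h1 h2; rewrite !ripE (ripC (H p) p) (ripC (H q) q).
have -> : '[p, H q] = '[q, H p] by rewrite -H_sa.1// ripC.
lra.
Qed.

End RealForm.

Theorem lemma3p9 (R : realType) (V : completeNormedModType R[i])
  (ip : {dot V for (@Num.conj R[i])}) (ip_norm : induces_norm ip)
  (A : operator V) (H : {linear V -> V})
  (A_sa : self_adjoint ip A) (A_ge0 : nonnegative_op ip A)
  (H_sa : self_adjoint ip (total_op H)) (H_bounded : bounded_op H)
  (H_inv : boundedly_invertible H)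
  (J : {linear V -> V}) (alpha : R)
  (J_invol : self_adjoint_involution ip J)
  (J_neq_id : (J : V -> V) <> (fun x => x))
  (J_neq_opp : (J : V -> V) <> (fun x => - x))
  (J_comm : commutes_with J A)
  (alpha_bounds : 0 < alpha <= 1)
  (PHP_ge : form_le ip setT
     (fun x => alpha%:C *: orth_proj J x)
     (fun x => orth_proj J (H (orth_proj J x))))
  (QHQ_le : form_le ip setT
     (fun x => orth_proj_perp J (H (orth_proj_perp J x)))
     (fun x => - (alpha%:C *: orth_proj_perp J x)))
  (sqrtA : operator V) (sqrtA_def : is_sqrt ip A sqrtA)
  (B : operator V)
  (B_def : associated_op ip (dom sqrtA) (sqrt_form ip sqrtA H) B)
  (absB : operator V) (absB_def : is_abs ip B absB)
  (sqrt_absB : operator V) (sqrt_absB_def : is_sqrt ip absB sqrt_absB) :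
  [\/ H @` dom sqrtA = dom sqrtA,
      strictly_positive ip (total_op H) \/ strictly_negative ip (total_op H)
    | semibounded ip B] ->
  dom sqrt_absB = dom sqrtA.
Proof.
move=> cases.
have S_sa := self_adjoint_selfadj (let: And3 h _ _ := sqrtA_def in h).
have S_i := @operator_i_linear R V sqrtA.
have [_ S_ge0 [domA SSA]] := sqrtA_def.
have [B0 DBD B_form0] := B_def; have B_sa := self_adjoint_selfadj B0.
have [C0 _ [domBB CCBB]] := absB_def; have C_sa := self_adjoint_selfadj C0.
have [T0 _ [domC TTC]] := sqrt_absB_def; have T_sa := self_adjoint_selfadj T0.
have T_i := @operator_i_linear R V sqrt_absB.
have B_form x y : dom sqrtA x -> dom B y -> rip ip (sqrtA x) (H (sqrtA y)) = rip ip x (B y).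
  by move=> Dx Dy; rewrite /rip -B_form0.
have H_sa' : selfadj ip setT H := self_adjoint_selfadj H_sa.
have TT_sa : selfadj ip (sq_dom (dom sqrt_absB) sqrt_absB) (sqrt_absB \o sqrt_absB).
  by apply: selfadj_ext C_sa => [|x Dx]; [exact: esym|rewrite -TTC// domC].
have SS_sa : selfadj ip (sq_dom (dom sqrtA) sqrtA) (sqrtA \o sqrtA).
  by apply: selfadj_ext (self_adjoint_selfadj A_sa) => [|x Dx]; [exact: esym|rewrite -SSA// domA].
have domCB : dom absB = dom B.
  apply/seteqP; split.
  - apply: (same_square_dom_sub ip_norm C_sa (@operator_i_linear R V absB) B_sa); last exact: CCBB.
    by move=> x; rewrite -[sq_dom _ B]domBB.
  - apply: (same_square_dom_sub ip_norm B_sa (@operator_i_linear R V B) C_sa).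
      by move=> x; rewrite -[sq_dom _ absB]/(dom (comp_op absB absB)) domBB.
    by move=> x Dx; rewrite -[B (B x)]CCBB// domBB.
have domTB : sq_dom (dom sqrt_absB) sqrt_absB = dom B by rewrite -domCB -domC.
have [K K_bound] := H_bounded.
pose M := `|K| + 1.
have M0 : 0 < M by rewrite ltr_pwDr.
have H_le x : nrm (H x) <= M * nrm x.
  have := K_bound x; rewrite !nrmE -rmorphM lecR => /le_trans; apply.
  by rewrite ler_wpM2r ?nrm_ge0// ler_wpDr// ler_norm.
have semibounded_case : semibounded ip B -> dom sqrt_absB = dom sqrtA.
  have [_ J0 JK] := J_invol.
  have J_sa : selfadj ip setT J := self_adjoint_selfadj J0.
  have J_i : i_linear setT J by move=> x _; split=> //; rewrite linearZ.
  have [alpha0 alpha1] := andP alpha_bounds.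
  have JS : forall x, dom sqrtA x -> dom sqrtA (J x) /\ sqrtA (J x) = J (sqrtA x).
    apply: (sqrt_commute ip_norm S_sa S_i _ J_sa JK).
      move=> x Dx; have := form_le_rip S_ge0 Dx.
      by rewrite /scalar_op scale0r rip0l.
    have [JA1 JA2] := J_comm.
    move=> x; rewrite -[sq_dom _ _]/(dom (comp_op sqrtA sqrtA)) => Dx.
    have DJx : dom (comp_op sqrtA sqrtA) (J x).
      by rewrite domA; apply: JA1; rewrite -domA.
    split=> //.
    have -> : sqrtA (sqrtA x) = A x by exact: SSA.
    have -> : sqrtA (sqrtA (J x)) = A (J x) by exact: SSA.
    by apply: JA2; rewrite -domA.
  have H_coercive u := block_coercive ip_norm u H_sa' JK PHP_ge QHQ_le J_sa.
  case=> [[c B_ge]|[c B_le]].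
    apply: (semibounded_sqrt_dom ip_norm S_sa S_i H_sa' M0 H_le J_sa JK J_i JS alpha0 alpha1
      H_coercive B_sa DBD B_form (c := c) _ T_sa T_i TT_sa domTB) => x Dx.
    by have := form_le_rip B_ge Dx; rewrite ripZl ripxx.
  have J_iN : i_linear setT (fun x => - J x).
    by move=> x _; split=> //; rewrite (J_i _ I).2 scalerN.
  apply: (semibounded_sqrt_dom ip_norm S_sa S_i (selfadj_opp H_sa') M0 _ (selfadj_opp J_sa) _ J_iN
    _ alpha0 alpha1 _ (selfadj_opp B_sa) DBD _ (c := - c) _ T_sa T_i TT_sa domTB).
  - by move=> x; rewrite nrmN.
  - by move=> x; rewrite linearN opprK JK.
  - move=> x Dx; have [DJx SJx] := JS x Dx.
    have [DNx SNx] := selfadjZ S_sa (-1) DJx.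
    move: DNx SNx; rewrite rmorphN1 !scaleN1r => DNx ->; by rewrite SJx.
  - by move=> u; rewrite ripNl ripNr opprK; exact: H_coercive.
  - by move=> x y Dx Dy; rewrite !ripNr B_form.
  - move=> x Dx; have := form_le_rip B_le Dx; rewrite ripZl ripxx// ripNl mulNr; lra.
have scalar_ge0 (c : R) u : 0 < c -> 0 <= ip u (scalar_op c u).
  move=> c0; rewrite /scalar_op linearZr_LR /= -ip_norm.
  by rewrite mulr_ge0 ?exprn_ge0// conjC_ge0 ler0c ltW.
have [Hg [_ HK _]] := H_inv.
case: cases => [HD|H_def|]; last exact: semibounded_case.
- have domBA : dom B = sq_dom (dom sqrtA) sqrtA.
    apply/seteqP; split=> x.
      move=> DBx; have Dx := DBD x DBx; split=> //.
      have [|DHSx _] := S_sa.2 (H (sqrtA x)) (B x); first by move=> w Dw; exact: B_form.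
      have [u Du /(can_inj HK) <-//] : (H @` dom sqrtA) (H (sqrtA x)) by rewrite HD.
    move=> [Dx DSx]; have DHSx : dom sqrtA (H (sqrtA x)).
      by rewrite -HD; exists (sqrtA x).
    apply: (form_dom H_sa' B_sa DBD B_form Dx) => w Dw; exact: S_sa.1.
  apply/seteqP; split.
  - by apply: (sqrt_dom_sub ip_norm T_sa T_i S_sa TT_sa SS_sa); rewrite domTB domBA.
  - by apply: (sqrt_dom_sub ip_norm S_sa S_i T_sa SS_sa TT_sa); rewrite domTB domBA.
- case: H_def => -[c c0 H_ge]; apply: semibounded_case.
  + left; exists 0 => x Dx.
    rewrite /scalar_op scale0r linear0r -B_form0//; last exact: DBD.
    by apply: le_trans (H_ge (sqrtA x) I); exact: scalar_ge0.
  + right; exists 0 => x Dx.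
    rewrite /scalar_op scale0r linear0r -B_form0//; last exact: DBD.
    rewrite -oppr_ge0 -linearNr.
    by apply: le_trans (H_ge (sqrtA x) I); exact: scalar_ge0.
Qed.
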